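(* Let $\mathcal{A}$ be a Hopf $\ast$-algebra and $(\Gamma,d)$ a finite dimensional left-covariant first order differential $\ast$-calculus over $\mathcal{A}$. Let $\{\omega_1,\dots,\omega_n\}$ be a basis of the left-invariant elements of $\Gamma$ such that the associated functionals $X_1,\dots,X_n\in\mathcal{A}^\circ$ are hermitean, $X_j^\ast=X_j$, and let $f^k_j\in\mathcal{A}^\circ$ be the associated functionals describing the bimodule structure. Let $\mathcal{U}_0$ be a $\ast$-subalgebra of $\mathcal{A}^\circ$ containing all $X_j,f^k_j$, $k,j=1,\dots,n$, and let $\mathcal{A}\rtimes\mathcal{U}_0$ be the $\ast$-subalgebra of $\mathcal{A}\rtimes\mathcal{A}^\circ$ generated by $\mathcal{A}$ and $\mathcal{U}_0$. Let $\pi_1$ be a $\ast$-representation of $\mathcal{A}\rtimes\mathcal{U}_0$ on a domain $\mathcal{D}$. On $\mathcal{D}_{n+1}=\mathcal{D}\oplus\dots\oplus\mathcal{D}$ ($n+1$ summands) define $$\pi(a)(\varphi_0,\dots,\varphi_n)=(\pi_1(a)\varphi_0,\dots,\pi_1(a)\varphi_n),\qquad a\in\mathcal{A},$$ $$F(\varphi_0,\dots,\varphi_n)=\Big(\sum_{k=1}^n\pi_1(X_k)\varphi_k,\ \pi_1(X_1)\varphi_0,\ \dots,\ \pi_1(X_n)\varphi_0\Big).$$ Then the pair $(\pi,F)$ is a commutator representation of $\Gamma$. It is faithful if the $\ast$-representation $\pi_1$ is faithful.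
   Context: All algebras are unital and over $\mathbb{C}$; algebra homomorphisms preserve units. A first order differential calculus (FODC) over $\mathcal{A}$ is an $\mathcal{A}$-bimodule $\Gamma$ with a linear mapping $d:\mathcal{A}\to\Gamma$ such that $d(ab)=a\,db+da\,b$ and $\Gamma=\mathrm{Lin}\{a\,db:\ a,b\in\mathcal{A}\}$. If $\mathcal{A}$ is a $\ast$-algebra, the FODC is a $\ast$-calculus if there is a well-defined involution $\gamma\mapsto\gamma^\ast$ of the vector space $\Gamma$ with $(a\,db\,c)^\ast=c^\ast\, d(b^\ast)\, a^\ast$ for $a,b,c\in\mathcal{A}$. If $\mathcal{A}$ is a Hopf algebra, the FODC is left-covariant if there is a linear map $\Delta_L:\Gamma\to\mathcal{A}\otimes\Gamma$ with $\Delta_L(a\,db)=\Delta(a)(\mathrm{id}\otimes d)\Delta(b)$; $\omega\in\Gamma$ is left-invariant if $\Delta_L(\omega)=1\otimes\omega$; $\Gamma$ is finite dimensional if the space of left-invariant elements is. $\mathcal{A}^\circ$ is the dual Hopf algebra, a Hopf $\ast$-algebra with $f^\ast(a)=\overline{f(S(a)^\ast)}$. For $f\in\mathcal{A}^\circ$, $a\in\mathcal{A}$ put $f\triangleright a=a_{(1)}\langle f,a_{(2)}\rangle$. The functionals associated with a basis $\{\omega_k\}$ of left-invariant elements are the $X_k,f^k_j\in\mathcal{A}^\circ$ with $da=\sum_k(X_k\triangleright a)\omega_k$ and $\omega_k a=\sum_j(f^k_j\triangleright a)\omega_j$ for $a\in\mathcal{A}$. The linear span of $X_1,\dots,X_n$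 (the quantum tangent space) is $\ast$-invariant for a $\ast$-calculus, so a basis with all $X_j$ hermitean exists. The left cross product algebra $\mathcal{A}\rtimes\mathcal{A}^\circ$ is the vector space $\mathcal{A}\otimes\mathcal{A}^\circ$ with the product $(b\otimes f)(a\otimes g)=b(f_{(1)}\triangleright a)\otimes f_{(2)}g$; it contains $\mathcal{A}$ and $\mathcal{A}^\circ$ as subalgebras with cross relation $fa=(f_{(1)}\triangleright a)f_{(2)}$, and it is a $\ast$-algebra containing $\mathcal{A}$ and $\mathcal{A}^\circ$ as $\ast$-subalgebras. $L(\mathcal{D})$ denotes the linear mappings of $\mathcal{D}$ into itself. A $\ast$-representation of a $\ast$-algebra $\mathcal{X}$ on a domain $\mathcal{D}$ is an algebra homomorphism $\pi:\mathcal{X}\to L(\mathcal{D})$, $\mathcal{D}$ a dense linear subspace of a Hilbert space, with $\langle\pi(x)\varphi,\psi\rangle=\langle\varphi,\pi(x^\ast)\psi\rangle$ for $\varphi,\psi\in\mathcal{D}$. It is faithful if it is injective. A pair $(\pi,F)$ of a $\ast$-representation $\pi$ of $\mathcal{A}$ on a domain $\mathcal{E}$ and a symmetric linear operator $F\in L(\mathcal{E})$ is a commutator representation of a $\ast$-calculus $\Gamma$ over $\mathcal{A}$ if there is a (well-defined) linear mapping $\tau:\Gamma\to L(\mathcal{E})$ with $\tau(a\,db)=i\pi(a)(F\pi(b)-\pi(b)F)$ for all $a,b\in\mathcal{A}$. It is faithful if $\tau$ is injective. *)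

(* Defs.v *)
From HB Require Import structures.
From mathcomp Require Import all_boot all_order all_algebra.
From mathcomp Require Import sesquilinear zify ring.
From mathcomp Require Import all_classical.

Set Implicit Arguments.
Unset Strict Implicit.
Unset Printing Implicit Defensive.

Import Order.TTheory GRing.Theory Num.Theory.
Local Open Scope ring_scope.

Reserved Notation "v '\ox' w" (at level 40, left associativity).

Section Tensor.
Variables (K : comNzRingType) (V W : lmodType K).

(* A formal sum of pure tensors is the list of its terms. *)
Inductive tens_eq : seq (V * W) -> seq (V * W) -> Prop :=
| te_refl s : tens_eq s s
| te_sym s t : tens_eq s t -> tens_eq t s
| te_trans s t u : tens_eq s t -> tens_eq t u -> tens_eq s u
| te_cat s t s' t' : tens_eq s t -> tens_eq s' t' -> tens_eq (s ++ s') (t ++ t')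
| te_comm s t : tens_eq (s ++ t) (t ++ s)
| te_addl v v' w : tens_eq [:: (v + v', w)] [:: (v, w); (v', w)]
| te_addr v w w' : tens_eq [:: (v, w + w')] [:: (v, w); (v, w')]
| te_scale c v w : tens_eq [:: (c *: v, w)] [:: (v, c *: w)]
| te_zero w : tens_eq [:: (0, w)] [::].

Definition tens_rel : rel (seq (V * W)) := fun s t => `[< tens_eq s t >].

Lemma tens_rel_refl : reflexive tens_rel.
Proof. by move=> s; apply/asboolP; exact: te_refl. Qed.

Lemma tens_rel_sym : symmetric tens_rel.
Proof. by move=> s t; apply/asboolP/asboolP => /te_sym. Qed.

Lemma tens_rel_trans : transitive tens_rel.
Proof. by move=> s t u /asboolP h /asboolP /(te_trans h) h'; apply/asboolP. Qed.

Canonical tens_equiv := EquivRel tens_rel tens_rel_refl tens_rel_sym tens_rel_trans.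

Definition tensor := {eq_quot tens_equiv}%qT.
HB.instance Definition _ := Choice.on tensor.

Definition tcls (s : seq (V * W)) : tensor := (\pi_tensor s)%qT.
Definition tens (v : V) (w : W) : tensor := tcls [:: (v, w)].

Lemma tclsP s t : tcls s = tcls t <-> tens_eq s t.
Proof.
rewrite /tcls; split; first by move/eqmodP => /asboolP.
by move=> h; apply/eqmodP/asboolP.
Qed.

Lemma tclsK (t : tensor) : tcls (repr t) = t.
Proof. exact: reprK. Qed.

Definition tadd (s t : tensor) : tensor := tcls (repr s ++ repr t).
Definition tscale (c : K) (t : tensor) : tensor :=
  tcls [seq (c *: p.1, p.2) | p <- repr t].
Definition topp (t : tensor) : tensor := tscale (-1) t.

Lemma tcls_add s t : tadd (tcls s) (tcls t) = tcls (s ++ t).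
Proof. by apply/tclsP/te_cat; apply/tclsP; rewrite tclsK. Qed.

Lemma tens_eq_scale c s t : tens_eq s t ->
  tens_eq [seq (c *: p.1, p.2) | p <- s] [seq (c *: p.1, p.2) | p <- t].
Proof.
elim=> {s t} /=.
- by move=> s; exact: te_refl.
- by move=> s t _ /te_sym.
- by move=> s t u _ h _; exact: te_trans.
- by move=> s t s' t' _ h _ h'; rewrite !map_cat; exact: te_cat.
- by move=> s t; rewrite !map_cat; exact: te_comm.
- by move=> v v' w; rewrite scalerDr; exact: te_addl.
- by move=> v w w'; exact: te_addr.
- by move=> a v w; rewrite scalerA mulrC -scalerA; exact: te_scale.
- by move=> w; rewrite scaler0; exact: te_zero.
Qed.

Lemma tcls_scale c s : tscale c (tcls s) = tcls [seq (c *: p.1, p.2) | p <- s].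
Proof. by apply/tclsP/tens_eq_scale/tclsP; rewrite tclsK. Qed.

Lemma taddA : associative tadd.
Proof.
move=> s t u; rewrite -[s]tclsK -[t]tclsK -[u]tclsK.
by rewrite !tcls_add catA.
Qed.

Lemma taddC : commutative tadd.
Proof.
by move=> s t; rewrite -[s]tclsK -[t]tclsK !tcls_add; apply/tclsP/te_comm.
Qed.

Lemma tadd0 : left_id (tcls [::]) tadd.
Proof. by move=> t; rewrite -[t]tclsK tcls_add. Qed.

Lemma tcls_eq_map (f g : V * W -> V * W) s :
    (forall p, tens_eq [:: f p] [:: g p]) -> tcls (map f s) = tcls (map g s).
Proof.
move=> h; elim: s => //= p s /tclsP ih; apply/tclsP.
by rewrite -cat1s -[X in tens_eq _ X]cat1s; exact: te_cat.
Qed.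

Lemma tscaleDl t a b : tscale (a + b) t = tadd (tscale a t) (tscale b t).
Proof.
rewrite -[t]tclsK !tcls_scale tcls_add; apply/tclsP.
elim: (repr t) => /= [|p s ih]; first exact: te_refl.
rewrite -cat1s scalerDl; apply: te_trans (te_cat (te_addl _ _ _) ih) _ => /=.
rewrite -(cat1s (a *: p.1, p.2)) -[X in tens_eq _ X](cat1s (a *: p.1, p.2)).
apply: te_cat; first exact: te_refl.
set x := (b *: p.1, p.2).
rewrite -cat1s catA -[X in tens_eq _ (_ ++ X)]cat1s [X in tens_eq _ X]catA.
by apply: te_cat; [exact: te_comm|exact: te_refl].
Qed.

Lemma tscaleDr a : {morph tscale a : s t / tadd s t}.
Proof.
by move=> s t; rewrite -[s]tclsK -[t]tclsK !(tcls_add, tcls_scale) map_cat.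
Qed.

Lemma tscaleA a b t : tscale a (tscale b t) = tscale (a * b) t.
Proof.
rewrite -[t]tclsK !tcls_scale -map_comp; congr tcls; apply: eq_map => p /=.
by rewrite scalerA.
Qed.

Lemma tscale1 : left_id 1 tscale.
Proof.
move=> t; rewrite -[t]tclsK tcls_scale; congr tcls; rewrite -[RHS]map_id.
by apply: eq_map => -[v w] /=; rewrite scale1r.
Qed.

Lemma tscale0 t : tscale 0 t = tcls [::].
Proof.
rewrite -[t]tclsK tcls_scale; apply/tclsP.
elim: (repr t) => /= [|p s ih]; first exact: te_refl.
by rewrite -cat1s scale0r; exact: te_cat (te_zero _) ih.
Qed.

Lemma taddN : left_inverse (tcls [::]) topp tadd.
Proof.
move=> t; rewrite -{2}[t]tscale1 /topp -tscaleDl addNr; exact: tscale0.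
Qed.

HB.instance Definition _ := GRing.isZmodule.Build tensor taddA taddC tadd0 taddN.
HB.instance Definition _ :=
  GRing.Zmodule_isLmodule.Build K tensor tscaleA tscale1 tscaleDr
    (fun t a b => tscaleDl t a b).

Lemma tensDl v v' w : tens (v + v') w = tens v w + tens v' w.
Proof. by rewrite [RHS]tcls_add; apply/tclsP/te_addl. Qed.

Lemma tensDr v w w' : tens v (w + w') = tens v w + tens v w'.
Proof. by rewrite [RHS]tcls_add; apply/tclsP/te_addr. Qed.

Lemma tensZl c v w : tens (c *: v) w = c *: tens v w.
Proof. by rewrite [RHS]tcls_scale. Qed.

Lemma tensZr c v w : tens v (c *: w) = c *: tens v w.
Proof. by rewrite -tensZl; apply/tclsP/te_sym/te_scale. Qed.

Lemma tcls_sum s : tcls s = \sum_(p <- s) tens p.1 p.2.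
Proof.
elim: s => [|p s ih]; first by rewrite big_nil.
by rewrite big_cons -ih [RHS]tcls_add; case: p.
Qed.

Lemma tensor_sum (t : tensor) : t = \sum_(p <- repr t) tens p.1 p.2.
Proof. by rewrite -tcls_sum tclsK. Qed.

(* The map v \ox w |-> f v w; it does not depend on the chosen representative
   as soon as f is biadditive and balanced. *)
Definition tlift (U : zmodType) (f : V -> W -> U) (t : tensor) : U :=
  \sum_(p <- repr t) f p.1 p.2.

Record balanced (U : zmodType) (f : V -> W -> U) : Prop := Balanced {
  balDl : forall v v' w, f (v + v') w = f v w + f v' w;
  balDr : forall v w w', f v (w + w') = f v w + f v w';
  balZ : forall c v w, f (c *: v) w = f v (c *: w) }.

Section Lift.
Variables (U : zmodType) (f : V -> W -> U).
Hypothesis fB : balanced f.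

Lemma balanced_eq s t : tens_eq s t ->
  \sum_(p <- s) f p.1 p.2 = \sum_(p <- t) f p.1 p.2.
Proof.
have f0 w : f 0 w = 0.
  by apply: (addrI (f 0 w)); rewrite -(balDl fB) !addr0.
elim=> {s t} //=.
- by move=> s t u _ -> _ ->.
- by move=> s t s' t' _ h _ h'; rewrite !big_cat /= h h'.
- by move=> s t; rewrite !big_cat /= addrC.
- by move=> v v' w; rewrite !big_cons !big_nil !addr0 (balDl fB).
- by move=> v w w'; rewrite !big_cons !big_nil !addr0 (balDr fB).
- by move=> c v w; rewrite !big_cons !big_nil !addr0 (balZ fB).
- by move=> w; rewrite big_cons !big_nil addr0.
Qed.

Lemma tlift_cls s : tlift f (tcls s) = \sum_(p <- s) f p.1 p.2.
Proof. by apply: balanced_eq; apply/tclsP; rewrite tclsK. Qed.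

Lemma tliftE v w : tlift f (tens v w) = f v w.
Proof. by rewrite tlift_cls big_seq1. Qed.

Lemma tliftD : {morph tlift f : s t / s + t}.
Proof.
move=> s t; have -> : s + t = tcls (repr s ++ repr t) by [].
by rewrite tlift_cls big_cat.
Qed.

Lemma tlift0 : tlift f 0 = 0.
Proof. by have -> : 0 = tcls [::] :> tensor by []; rewrite tlift_cls big_nil. Qed.

Lemma tlift_sum I (r : seq I) (P : pred I) F :
  tlift f (\sum_(i <- r | P i) F i) = \sum_(i <- r | P i) tlift f (F i).
Proof. exact: (big_morph _ tliftD tlift0). Qed.

Lemma tliftZ c t :
  tlift f (c *: t) = \sum_(p <- repr t) f (c *: p.1) p.2.
Proof.
rewrite {1}[t]tensor_sum scaler_sumr tlift_sum; apply: eq_bigr => p _.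
by rewrite -tensZl tliftE.
Qed.

End Lift.

Lemma tensor_ext (U : zmodType) (f g : tensor -> U) :
    {morph f : s t / s + t} -> {morph g : s t / s + t} ->
  (forall v w, f (tens v w) = g (tens v w)) -> f =1 g.
Proof.
move=> fD gD fg t.
have f0 : f 0 = 0 by apply: (addrI (f 0)); rewrite -fD !addr0.
have g0 : g 0 = 0 by apply: (addrI (g 0)); rewrite -gD !addr0.
rewrite [t]tensor_sum (big_morph _ fD f0) (big_morph _ gD g0).
by apply: eq_bigr.
Qed.

End Tensor.

Notation "v \ox w" := (tens v w) : ring_scope.

Section TensorOps.
Variable K : comNzRingType.

Definition tmap (U V U' V' : lmodType K) (f : U -> U') (g : V -> V')
  (t : tensor U V) : tensor U' V' := tlift (fun u v => f u \ox g v) t.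

Definition tassoc (U V W : lmodType K) (t : tensor (tensor U V) W) :
  tensor U (tensor V W) :=
  tlift (fun s w => tlift (fun u v => u \ox (v \ox w)) s) t.

Definition tmul (A B : algType K) (s t : tensor A B) : tensor A B :=
  tlift (fun a b => tlift (fun a' b' => (a * a') \ox (b * b')) t) s.

Record tribalanced (U V W : lmodType K) (X : zmodType) (B : U -> V -> W -> X)
  : Prop := Tribalanced {
  tri1 : forall u u' v w, B (u + u') v w = B u v w + B u' v w;
  tri2 : forall u v v' w, B u (v + v') w = B u v w + B u v' w;
  tri3 : forall u v w w', B u v (w + w') = B u v w + B u v w';
  triZ1 : forall c u v w, B (c *: u) v w = B u (c *: v) w;
  triZ2 : forall c u v w, B u (c *: v) w = B u v (c *: w) }.

Lemma eq_tlift (V W : lmodType K) (X : zmodType) (f g : V -> W -> X) t :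
  (forall v w, f v w = g v w) -> tlift f t = tlift g t.
Proof. by move=> fg; apply: eq_bigr => p _. Qed.

Lemma tlift_comp (V W : lmodType K) (X Y : zmodType) (h : X -> Y)
    (f : V -> W -> X) t : {morph h : x y / x + y} ->
  h (tlift f t) = tlift (fun v w => h (f v w)) t.
Proof.
move=> hD; have h0 : h 0 = 0 by apply: (addrI (h 0)); rewrite -hD !addr0.
exact: (big_morph _ hD h0).
Qed.

Lemma tlift_swap (V W V' W' : lmodType K) (X : zmodType)
    (F : V -> W -> V' -> W' -> X) t t' :
  tlift (fun v w => tlift (F v w) t') t =
  tlift (fun v' w' => tlift (fun v w => F v w v' w') t) t'.
Proof. exact: exchange_big. Qed.

Lemma tliftfD (V W : lmodType K) (X : zmodType) (f g : V -> W -> X) t :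
  tlift (fun v w => f v w + g v w) t = tlift f t + tlift g t.
Proof. exact: big_split. Qed.

Lemma tlift_map (U V U' V' : lmodType K) (X : zmodType) (f : U -> U')
    (g : V -> V') (h : U' -> V' -> X) t : balanced h ->
  tlift h (tmap f g t) = tlift (fun u v => h (f u) (g v)) t.
Proof.
move=> hB; rewrite (tlift_comp _ _ (tliftD hB)); apply: eq_tlift => u v.
exact: tliftE.
Qed.

Lemma tens0l (V W : lmodType K) (w : W) : (0 : V) \ox w = 0.
Proof. by rewrite -(scale0r (0 : V)) tensZl scale0r. Qed.

Lemma tens0r (V W : lmodType K) (v : V) : v \ox (0 : W) = 0.
Proof. by rewrite -(scale0r (0 : W)) tensZr scale0r. Qed.

Lemma tens_suml (V W : lmodType K) I (r : seq I) (F : I -> V) (w : W) :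
  (\sum_(i <- r) F i) \ox w = \sum_(i <- r) F i \ox w.
Proof.
by rewrite (big_morph (fun v => v \ox w) (fun v v' => tensDl v v' w) (tens0l _ w)).
Qed.

Lemma tens_sumr (V W : lmodType K) I (r : seq I) (F : I -> W) (v : V) :
  v \ox (\sum_(i <- r) F i) = \sum_(i <- r) v \ox F i.
Proof. exact: (big_morph _ (tensDr v) (tens0r _ v)). Qed.

Lemma tens_bal (V W : lmodType K) : balanced (@tens K V W).
Proof.
split=> *; first exact: tensDl; first exact: tensDr.
by rewrite tensZl tensZr.
Qed.

Lemma tens_tri (U V W : lmodType K) :
  tribalanced (fun (u : U) (v : V) (w : W) => u \ox (v \ox w)).
Proof.
by split=> *; rewrite ?(tensDl, tensDr, tensZl, tensZr).
Qed.

Lemma tri_bal12 (U V W : lmodType K) (X : zmodType) (B : U -> V -> W -> X) w :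
  tribalanced B -> balanced (fun u v => B u v w).
Proof. by case=> h1 h2 h3 h4 h5; split=> *; rewrite (h1, h2, h4). Qed.

Lemma tri_bal23 (U V W : lmodType K) (X : zmodType) (B : U -> V -> W -> X) u :
  tribalanced B -> balanced (B u).
Proof. by case=> h1 h2 h3 h4 h5; split=> *; rewrite (h2, h3, h5). Qed.

Lemma tliftfZ (V W : lmodType K) (X : zmodType) (f : V -> W -> X) c t :
  balanced f -> tlift f (c *: t) = tlift (fun v w => f (c *: v) w) t.
Proof. by move=> fB; rewrite (tliftZ fB). Qed.

Lemma tri_lift12 (U V W : lmodType K) (X : zmodType) (B : U -> V -> W -> X) :
  tribalanced B -> balanced (fun t w => tlift (fun u v => B u v w) t).
Proof.
move=> BT; split=> [s t w|t w w'|c t w].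
- exact/tliftD/tri_bal12.
- by rewrite -tliftfD; apply: eq_tlift => u v; exact: tri3.
- rewrite tliftfZ; last exact: tri_bal12.
  by apply: eq_tlift => u v; rewrite (triZ1 BT) (triZ2 BT).
Qed.

Lemma tri_lift23 (U V W : lmodType K) (X : zmodType) (B : U -> V -> W -> X) :
  tribalanced B -> balanced (fun u t => tlift (fun v w => B u v w) t).
Proof.
move=> BT; split=> [u u' t|u t t'|c u t].
- by rewrite -tliftfD; apply: eq_tlift => v w; exact: tri1.
- exact/tliftD/tri_bal23.
- rewrite tliftfZ; last exact: tri_bal23.
  by apply: eq_tlift => v w; rewrite (triZ1 BT).
Qed.

Lemma tlift_assoc (U V W : lmodType K) (X : zmodType) (B : U -> V -> W -> X) t :
  tribalanced B ->
  tlift (fun u s => tlift (fun v w => B u v w) s) (tassoc t) =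
  tlift (fun s w => tlift (fun u v => B u v w) s) t.
Proof.
move=> BT; have B23 := tri_lift23 BT.
rewrite (tlift_comp _ _ (tliftD B23)); apply: eq_tlift => s w.
rewrite (tlift_comp _ _ (tliftD B23)); apply: eq_tlift => u v.
by rewrite (tliftE B23) (tliftE (tri_bal23 u BT)).
Qed.

Lemma tmul_balr (A B : algType K) (a : A) (b : B) :
  balanced (fun a' b' => (a * a') \ox (b * b')).
Proof.
by split=> *; rewrite ?(mulrDr, tensDl, tensDr) // -!scalerAr tensZl tensZr.
Qed.

Lemma tmul_ball (A B : algType K) (t : tensor A B) :
  balanced (fun a b => tlift (fun a' b' => (a * a') \ox (b * b')) t).
Proof.
split=> [a a' b|a b b'|c a b]; rewrite -?tliftfD; apply: eq_tlift => v w.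
- by rewrite mulrDl tensDl.
- by rewrite mulrDl tensDr.
- by rewrite -!scalerAl tensZl tensZr.
Qed.

Lemma tmulE (A B : algType K) (a a' : A) (b b' : B) :
  tmul (a \ox b) (a' \ox b') = (a * a') \ox (b * b').
Proof. by rewrite /tmul (tliftE (tmul_ball _)) (tliftE (tmul_balr _ _)). Qed.

Lemma tmulDl (A B : algType K) (s s' t : tensor A B) :
  tmul (s + s') t = tmul s t + tmul s' t.
Proof. exact: tliftD (tmul_ball _) _ _. Qed.

Lemma tmulDr (A B : algType K) (s t t' : tensor A B) :
  tmul s (t + t') = tmul s t + tmul s t'.
Proof.
rewrite -tliftfD; apply: eq_tlift => a b; exact: tliftD (tmul_balr _ _) _ _.
Qed.

Lemma tmulA (A B : algType K) (s t u : tensor A B) :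
  tmul s (tmul t u) = tmul (tmul s t) u.
Proof.
move: s; apply: tensor_ext => [s s'|s s'|a b]; rewrite ?tmulDl //.
move: t; apply: tensor_ext => [t t'|t t'|a' b']; rewrite ?(tmulDl, tmulDr) //.
move: u; apply: tensor_ext => [u u'|u u'|a'' b'']; rewrite ?tmulDr //.
by rewrite !tmulE !mulrA.
Qed.

End TensorOps.

HB.mixin Record Algebra_isStarAlgebra (C : numClosedFieldType) A
    of GRing.Algebra C A := {
  star : A -> A;
  starK : involutive star;
  starD : {morph star : a b / a + b};
  starZ : forall c a, star (c *: a) = c^* *: star a;
  starM : forall a b, star (a * b) = star b * star a }.

#[short(type="starAlgType")]
HB.structure Definition StarAlgebra (C : numClosedFieldType) :=
  {A of GRing.Algebra C A & Algebra_isStarAlgebra C A}.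

HB.mixin Record StarAlgebra_isHopfStarAlgebra (C : numClosedFieldType) A
    of StarAlgebra C A := {
  comul : A -> tensor A A;
  counit : A -> C;
  antipode : A -> A;
  comul_linear : linear comul;
  counit_scalar : scalar counit;
  antipode_linear : linear antipode;
  comulA : forall a,
    tassoc (tmap comul id (comul a)) = tmap id comul (comul a);
  counitl : forall a, tlift (fun x y => counit x *: y) (comul a) = a;
  counitr : forall a, tlift (fun x y => counit y *: x) (comul a) = a;
  comul1 : comul 1 = 1 \ox 1;
  comulM : forall a b, comul (a * b) = tmul (comul a) (comul b);
  counit1 : counit 1 = 1;
  counitM : {morph counit : a b / a * b};
  antipodel : forall a, tlift (fun x y => antipode x * y) (comul a) = (counit a)%:A;
  antipoder : forall a, tlift (fun x y => x * antipode y) (comul a) = (counit a)%:A;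
  comul_star : forall a, comul (star a) = tmap star star (comul a) }.

#[short(type="hopfStarAlgType")]
HB.structure Definition HopfStarAlgebra (C : numClosedFieldType) :=
  {A of StarAlgebra C A & StarAlgebra_isHopfStarAlgebra C A}.

Ltac pullZ := do 4! (rewrite -?scalerAl -?scalerAr ?linearZ ?starZ ?tensZl ?tensZr /=).
Ltac bal := split=> *;
  rewrite ?(raddfD, starD, mulrDl, mulrDr, tensDl, tensDr, scalerDl, scalerDr) //;
  pullZ; rewrite ?scalerA ?mulrA //.

Section HopfTheory.
Variables (C : numClosedFieldType) (A : hopfStarAlgType C).
Implicit Types (a b : A).

HB.instance Definition _ :=
  GRing.isLinear.Build C A (tensor A A) *:%R (@comul C A) comul_linear.
HB.instance Definition _ :=
  GRing.isLinear.Build C A C *%R (@counit C A) counit_scalar.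
HB.instance Definition _ :=
  GRing.isLinear.Build C A A *:%R (@antipode C A) antipode_linear.

Local Notation S := (@antipode C A).
Local Notation eps := (@counit C A).

(* [sw a f] is the Sweedler sum of f a_(1) a_(2). *)
Definition sw (X : zmodType) (a : A) (f : A -> A -> X) : X := tlift f (comul a).

Lemma eq_sw (X : zmodType) a (f g : A -> A -> X) :
  (forall x y, f x y = g x y) -> sw a f = sw a g.
Proof. exact: eq_tlift. Qed.

Lemma sw_comp (X Y : zmodType) (h : X -> Y) (f : A -> A -> X) a :
  {morph h : x y / x + y} -> h (sw a f) = sw a (fun x y => h (f x y)).
Proof. exact: tlift_comp. Qed.

Lemma swfD (X : zmodType) (f g : A -> A -> X) a :
  sw a (fun v w => f v w + g v w) = sw a f + sw a g.
Proof. exact: tliftfD. Qed.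

Lemma sw_swap (X : zmodType) (F : A -> A -> A -> A -> X) a b :
  sw a (fun v w => sw b (F v w)) =
  sw b (fun v' w' => sw a (fun v w => F v w v' w')).
Proof. exact: tlift_swap. Qed.

Lemma sw_sum (X : zmodType) I (r : seq I) (F : I -> A -> A -> X) a :
  sw a (fun x y => \sum_(i <- r) F i x y) = \sum_(i <- r) sw a (F i).
Proof. exact: exchange_big. Qed.

Lemma swD (X : zmodType) (f : A -> A -> X) a b :
  balanced f -> sw (a + b) f = sw a f + sw b f.
Proof. by move=> fB; rewrite /sw raddfD /=; apply: tliftD. Qed.

Lemma swZ (X : zmodType) (f : A -> A -> X) c a :
  balanced f -> sw (c *: a) f = sw a (fun x y => f (c *: x) y).
Proof. by move=> fB; rewrite /sw linearZ /=; apply: tliftfZ. Qed.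

Lemma sw_scale (X : lmodType C) (f : A -> A -> X) c a :
  c *: sw a f = sw a (fun x y => c *: f x y).
Proof. by apply: sw_comp => x y; rewrite scalerDr. Qed.

Lemma sw1 (X : zmodType) (f : A -> A -> X) : balanced f -> sw 1 f = f 1 1.
Proof. by move=> fB; rewrite /sw comul1 tliftE. Qed.

Lemma sw_mull a b (f : A -> A -> A) : b * sw a f = sw a (fun x y => b * f x y).
Proof. by apply: (sw_comp (h := fun x => b * x)) => x y; rewrite mulrDr. Qed.

Lemma sw_mulr a b (f : A -> A -> A) : sw a f * b = sw a (fun x y => f x y * b).
Proof. by apply: (sw_comp (h := fun x => x * b)) => x y; rewrite mulrDl. Qed.

Lemma swA (X : zmodType) (B : A -> A -> A -> X) a : tribalanced B ->
  sw a (fun x z => sw x (fun u v => B u v z)) =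
  sw a (fun u y => sw y (fun v z => B u v z)).
Proof.
move=> BT; have B23 := tri_lift23 BT.
have := congr1 (tlift (fun u t => tlift (fun v w => B u v w) t)) (comulA a).
rewrite tlift_assoc // !tlift_map //; exact: tri_lift12.
Qed.

Lemma swM (X : zmodType) (f : A -> A -> X) a b : balanced f ->
  sw (a * b) f = sw a (fun x y => sw b (fun u v => f (x * u) (y * v))).
Proof.
move=> fB; rewrite /sw comulM (tlift_comp _ _ (tliftD fB)).
apply: eq_tlift => x y; rewrite (tlift_comp _ _ (tliftD fB)).
by apply: eq_tlift => u v; rewrite tliftE.
Qed.

Lemma sw_star (X : zmodType) (f : A -> A -> X) a : balanced f ->
  sw (star a) f = sw a (fun x y => f (star x) (star y)).
Proof. by move=> fB; rewrite /sw comul_star tlift_map. Qed.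

Lemma sw_counitl (X : lmodType C) (f : A -> X) a :
    {morph f : x y / x + y} -> (forall c x, f (c *: x) = c *: f x) ->
  sw a (fun x y => eps x *: f y) = f a.
Proof.
move=> fD fZ; rewrite -[in RHS](counitl a) [RHS]tlift_comp //.
by apply: eq_tlift => x y; rewrite fZ.
Qed.

Lemma sw_counitr (X : lmodType C) (f : A -> X) a :
    {morph f : x y / x + y} -> (forall c x, f (c *: x) = c *: f x) ->
  sw a (fun x y => eps y *: f x) = f a.
Proof.
move=> fD fZ; rewrite -[in RHS](counitr a) [RHS]tlift_comp //.
by apply: eq_tlift => x y; rewrite fZ.
Qed.

Lemma sw_antipodel a : sw a (fun x y => S x * y) = (eps a)%:A.
Proof. exact: antipodel. Qed.

Lemma sw_antipoder a : sw a (fun x y => x * S y) = (eps a)%:A.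
Proof. exact: antipoder. Qed.

Lemma antipodeM a b : S (a * b) = S b * S a.
Proof.
pose B u v z := sw b (fun y w => sw y (fun p q => S (u * p) * (v * q) * (S w * S z))).
have Bb2 u v z : tribalanced (fun p q w => S (u * p) * (v * q) * (S w * S z)).
  by bal.
have BT : tribalanced B.
  split=> *; rewrite /B -?swfD; apply: eq_sw => y w; rewrite -?swfD;
  apply: eq_sw => p q; rewrite ?(raddfD, mulrDl, mulrDr) //;
  by pullZ.
have := swA a BT; rewrite /B {BT B}.
have -> : sw a (fun x z => sw x (fun u v => sw b (fun y w => sw y (fun p q =>
    S (u * p) * (v * q) * (S w * S z))))) = S b * S a.
  transitivity (sw a (fun x z => eps x *: (S b * S z))); last first.
    apply: (@sw_counitl _ (fun z => S b * S z)) => [z z'|c z].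
      by rewrite raddfD mulrDr.
    by rewrite linearZ -scalerAr.
  apply: eq_sw => x z; rewrite sw_swap.
  transitivity (sw b (fun y w => eps y *: (eps x *: (S w * S z)))); last first.
    rewrite (@sw_counitl _ (fun w => eps x *: (S w * S z))) // => [w w'|c w].
      by rewrite raddfD mulrDl scalerDr.
    by rewrite linearZ -scalerAl !scalerA mulrC.
  apply: eq_sw => y w.
  transitivity (sw (x * y) (fun p q => S p * q) * (S w * S z)).
    rewrite swM; last by bal.
    rewrite sw_mulr; apply: eq_sw => u v; rewrite sw_mulr.
    by [].
  by rewrite sw_antipodel counitM -scalerAl mul1r scalerA mulrC.
move=> ->.
transitivity (sw a (fun u y => eps y *: sw b (fun p w => eps w *: S (u * p)))).
  rewrite (@sw_counitr _ (fun u => sw b (fun p w => eps w *: S (u * p)))).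
  - rewrite (@sw_counitr _ (fun p => S (a * p))) // => [p p'|c p].
      by rewrite mulrDr raddfD.
    by rewrite -scalerAr linearZ.
  - move=> u u'; rewrite -swfD; apply: eq_sw => p w.
    by rewrite mulrDl raddfD scalerDr.
  - move=> c u; rewrite sw_scale; apply: eq_sw => p w.
    by rewrite -scalerAl linearZ /= !scalerA mulrC.
apply: eq_sw => u y.
transitivity (sw y (fun v z => sw b (fun p w => eps w *: (S (u * p) * (v * S z))))).
  rewrite sw_swap sw_scale; apply: eq_sw => p w.
  rewrite -sw_scale -sw_mull sw_antipoder -scalerAr mulr1 !scalerA.
  by rewrite mulrC.
apply: eq_sw => v z.
have BT' := Bb2 u v z.
rewrite (swA b BT'); apply: eq_sw => p w.
transitivity (S (u * p) * v * sw w (fun q w => q * S w) * S z).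
  rewrite sw_antipoder -scalerAr mulr1 -scalerAl.
  by rewrite !mulrA.
by rewrite sw_mull sw_mulr; apply: eq_sw => q r; rewrite !mulrA.
Qed.

Lemma antipode1 : S 1 = 1.
Proof.
have := sw_antipodel 1; rewrite sw1; last by bal.
by rewrite mulr1 counit1 scale1r.
Qed.

Lemma tmul1l (t : tensor A A) : tmul (1 \ox 1) t = t.
Proof.
move: t; apply: tensor_ext => // [s t|v w]; first exact: tmulDr.
by rewrite tmulE !mul1r.
Qed.

Lemma tmul1r (t : tensor A A) : tmul t (1 \ox 1) = t.
Proof.
move: t; apply: tensor_ext => // [s t|v w]; first exact: tmulDl.
by rewrite tmulE !mulr1.
Qed.

Lemma tmulZl c (s t : tensor A A) : tmul (c *: s) t = c *: tmul s t.
Proof.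
move: s; apply: tensor_ext => [s s'|s s'|v w].
- by rewrite scalerDr tmulDl.
- by rewrite tmulDl scalerDr.
move: t; apply: tensor_ext => [s s'|s s'|v' w'].
- by rewrite tmulDr.
- by rewrite tmulDr scalerDr.
by rewrite -tensZl !tmulE -scalerAl tensZl.
Qed.

Lemma tmulZr c (s t : tensor A A) : tmul s (c *: t) = c *: tmul s t.
Proof.
move: s; apply: tensor_ext => [s s'|s s'|v w].
- by rewrite tmulDl.
- by rewrite tmulDl scalerDr.
move: t; apply: tensor_ext => [s s'|s s'|v' w'].
- by rewrite scalerDr tmulDr.
- by rewrite tmulDr scalerDr.
by rewrite -tensZl !tmulE -scalerAr tensZl.
Qed.

Let flipS z := sw z (fun x y => S y \ox S x).

Lemma flipS_bal : balanced (fun x y => S y \ox S x).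
Proof. by bal. Qed.

Lemma tmul_flipS x z : tmul (comul x) (flipS z) =
  sw x (fun u v => sw z (fun r s => (u * S s) \ox (v * S r))).
Proof.
apply: eq_tlift => u v; rewrite (tlift_comp _ _ (tliftD (tmul_balr u v))).
by apply: eq_tlift => r s; rewrite (tliftE (tmul_balr u v)).
Qed.

Lemma sw_flipS a :
  sw a (fun x z => tmul (comul x) (flipS z)) = eps a *: (1 \ox 1).
Proof.
have BT u : tribalanced (fun v r s => (u * S s) \ox (v * S r)) by bal.
have BT2 : tribalanced
    (fun u v z => sw z (fun r s => (u * S s) \ox (v * S r))).
  have b u v : balanced (fun r s => (u * S s) \ox (v * S r)) by bal.
  split=> [u u' v w|u v v' w|u v w w'|c u v w|c u v w].
  - by rewrite -swfD; apply: eq_sw => r s; rewrite mulrDl tensDl.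
  - by rewrite -swfD; apply: eq_sw => r s; rewrite mulrDl tensDr.
  - by rewrite swD.
  - by apply: eq_sw => r s; pullZ.
  - by rewrite swZ //; apply: eq_sw => r s; pullZ.
under eq_sw => x z do rewrite tmul_flipS.
rewrite (swA a BT2).
transitivity (sw a (fun u y => (u * S y) \ox (1 : A))); last first.
  rewrite -(sw_comp (h := fun t => t \ox (1 : A))); last first.
    by move=> x y; rewrite tensDl.
  by rewrite sw_antipoder tensZl.
apply: eq_sw => u y; rewrite -(swA y (BT u)).
rewrite -(@sw_counitl _ (fun s => (u * S s) \ox (1 : A)) y); last 2 first.
- by move=> s s'; rewrite raddfD mulrDr tensDl.
- by move=> c s; pullZ.
apply: eq_sw => m s; rewrite -(sw_comp (h := fun t => (u * S s) \ox t)).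
  by rewrite sw_antipoder tensZr.
by move=> t t'; rewrite tensDr.
Qed.

Lemma comul_antipode a : comul (S a) = flipS a.
Proof.
pose B u v z := tmul (tmul (comul (S u)) (comul v)) (flipS z).
have BT : tribalanced B.
  split=> *; rewrite /B.
  - by rewrite !raddfD /= !tmulDl.
  - by rewrite !raddfD /= tmulDr tmulDl.
  - by rewrite /flipS swD ?tmulDr //; exact: flipS_bal.
  - by rewrite !linearZ /= !(tmulZl, tmulZr).
  - rewrite !linearZ /= !(tmulZl, tmulZr) /flipS swZ; last exact: flipS_bal.
    rewrite -tmulZr sw_scale; congr tmul; apply: eq_sw => x y.
    by rewrite linearZ tensZr.
have := swA a BT; rewrite /B {BT B}.
have -> : sw a (fun x z => sw x (fun u v =>
    tmul (tmul (comul (S u)) (comul v)) (flipS z))) = flipS a.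
  rewrite -[RHS](@sw_counitl _ flipS); last 2 first.
  - by move=> x y; apply: swD flipS_bal.
  - move=> c x; rewrite /flipS swZ; last exact: flipS_bal.
    by rewrite sw_scale; apply: eq_sw => u v; pullZ.
  apply: eq_sw => x z.
  rewrite -(sw_comp (h := fun t => tmul t (flipS z))); last first.
    by move=> s t; rewrite tmulDl.
  transitivity (tmul (comul (sw x (fun u v => S u * v))) (flipS z)).
    congr tmul; rewrite [RHS]sw_comp; last exact: raddfD.
    by apply: eq_sw => u v; rewrite comulM.
  by rewrite sw_antipodel linearZ /= comul1 tmulZl tmul1l.
move=> ->; rewrite -[LHS](@sw_counitr _ (fun u => comul (S u))); last 2 first.
- by move=> x y; rewrite !raddfD.
- by move=> c x; rewrite !linearZ.
apply: eq_sw => u y; under [RHS]eq_sw => v z do rewrite -tmulA.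
rewrite -(sw_comp (h := fun t => tmul (comul (S u)) t)).
  by rewrite sw_flipS tmulZr tmul1r.
by move=> s t; rewrite tmulDr.
Qed.

Lemma sw_antipode (X : zmodType) (f : A -> A -> X) a : balanced f ->
  sw (S a) f = sw a (fun x y => f (S y) (S x)).
Proof.
move=> fB; rewrite {1}/sw comul_antipode (tlift_comp _ _ (tliftD fB)).
by apply: eq_tlift => x y; rewrite tliftE.
Qed.

Lemma star1 : star 1 = 1 :> A.
Proof. by rewrite -[LHS]mulr1 -{2}[1]starK -starM mulr1 starK. Qed.

Lemma counit_star a : eps (star a) = (eps a)^*.
Proof.
have h : sw a (fun x y => (eps (star x))^* *: y) = a.
  apply: (can_inj (@starK C A)); rewrite (sw_comp _ _ (@starD C A)).
  under eq_sw => x y do rewrite starZ conjCK.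
  rewrite -(sw_star (f := fun x y => eps x *: y)); first exact: counitl.
  by bal; rewrite mulrC.
rewrite -[in RHS]h [in RHS]sw_comp; last exact: raddfD.
rewrite -[in LHS](counitr a) [in star _]tlift_comp; last exact: starD.
rewrite [LHS]tlift_comp; last exact: raddfD.
rewrite -/(sw a _) [RHS](sw_comp _ _ (rmorphD _)).
by apply: eq_sw => x y; rewrite starZ !linearZ /= rmorphM /= conjCK mulrC.
Qed.

(* The inverse of the antipode. *)
Definition cantipode (a : A) : A := star (S (star a)).
Local Notation T := cantipode.

Lemma cantipodeD : {morph T : a b / a + b}.
Proof. by move=> a b; rewrite /T starD raddfD starD. Qed.

Lemma cantipodeZ c a : T (c *: a) = c *: T a.
Proof. by rewrite /T starZ linearZ starZ conjCK. Qed.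

Lemma sw_cantipodel a : sw a (fun x y => T y * x) = (eps a)%:A.
Proof.
apply: (can_inj (@starK C A)); rewrite (sw_comp _ _ (@starD C A)).
under eq_sw => x y do rewrite starM starK.
rewrite -(sw_star (f := fun x y => x * S y)); last by bal.
by rewrite sw_antipoder counit_star starZ star1.
Qed.

Lemma sw_cantipoder a : sw a (fun x y => y * T x) = (eps a)%:A.
Proof.
apply: (can_inj (@starK C A)); rewrite (sw_comp _ _ (@starD C A)).
under eq_sw => x y do rewrite starM starK.
rewrite -(sw_star (f := fun x y => S x * y)); last by bal.
by rewrite sw_antipodel counit_star starZ star1.
Qed.

Lemma cantipodeK a : S (T a) = a.
Proof.
have BT : tribalanced (fun u v z => u * S v * S (T z)).
  split=> *; rewrite ?(cantipodeD, raddfD, mulrDl, mulrDr) //;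
  by rewrite ?cantipodeZ; pullZ.
have := swA a BT.
have -> : sw a (fun x z => sw x (fun u v => u * S v * S (T z))) = S (T a).
  rewrite -[RHS](@sw_counitl _ (fun z => S (T z))); last 2 first.
  - by move=> x y; rewrite cantipodeD raddfD.
  - by move=> c x; rewrite cantipodeZ linearZ.
  by apply: eq_sw => x z; rewrite -sw_mulr sw_antipoder -scalerAl mul1r.
move=> ->; rewrite -[RHS](@counitr C A).
apply: eq_sw => u y; transitivity (u * S (sw y (fun v z => T z * v))).
  rewrite [in RHS]sw_comp; last exact: raddfD.
  by rewrite sw_mull; apply: eq_sw => v z; rewrite antipodeM mulrA.
by rewrite sw_cantipodel linearZ /= antipode1 -scalerAr mulr1.
Qed.

Lemma star_antipodeK a : star (S (star (S a))) = a.
Proof.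
by have := cantipodeK (star a); rewrite /T starK => ->; rewrite starK.
Qed.

End HopfTheory.

(* Finitely many functions are determined by their values at finitely many
   points. *)
Lemma rank_points (F : fieldType) (I : Type) n (g : 'I_n -> I -> F) :
  exists m (a : 'I_m -> I) (P : 'M[F]_(n, m)),
  forall k i, g k i = \sum_k' g k' i * \sum_l P k' l * g k (a l).
Proof.
pose M m (a : 'I_m -> I) : 'M[F]_(m, n) := \matrix_(l, k) g k (a l).
pose v i : 'rV[F]_n := \row_k g k i.
suff [m [a ha]] : exists m (a : 'I_m -> I), forall i, (v i <= M m a)%MS.
  exists m, a, (pinvmx (M m a)) => k i.
  have /rowP/(_ k) := mulmxKpV (ha i); rewrite -mulmxA !mxE => <-.
  apply: eq_bigr => k' _; rewrite !mxE; congr (_ * _).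
  by apply: eq_bigr => l _; rewrite !mxE.
suff h d m (a : 'I_m -> I) : (n - \rank (M m a) <= d)%N ->
    exists m' (a' : 'I_m' -> I), forall i, (v i <= M m' a')%MS.
  by apply: (h n 0%N (fun l => False_rect _ (notF (ltn_ord l)))); exact: leq_subr.
elim: d m a => [|d ih] m a hd.
  exists m, a => i; apply: submx_full; rewrite /row_full eqn_leq rank_leq_col.
  by rewrite -subn_eq0 -leqn0.
have [ha|/existsNP[i /negP hi]] := pselect (forall i, (v i <= M m a)%MS).
  by exists m, a.
pose a' l := if unlift ord0 l is Some l' then a l' else i.
apply: (ih m.+1 a').
have r0 : v i = row ord0 (M m.+1 a').
  by apply/rowP => k; rewrite !mxE /a' unlift_none.
have rl : (M m a <= M m.+1 a')%MS.
  apply/row_subP => l.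
  have -> : row l (M m a) = row (lift ord0 l) (M m.+1 a').
    by apply/rowP => k; rewrite !mxE /a' liftK.
  exact: row_sub.
have : (\rank (M m a) < \rank (M m.+1 a'))%N.
  rewrite ltn_neqAle mxrankS // andbT; apply: contra hi => /eqP e.
  rewrite r0; apply: submx_trans (row_sub _ _) _.
  by rewrite -(geq_leqif (mxrank_leqif_sup rl)) e.
have := rank_leq_col (M m.+1 a').
move: hd; lia.
Qed.

Section Dual.
Variables (C : numClosedFieldType) (A : hopfStarAlgType C).
Local Notation S := (@antipode C A).

(* f belongs to the dual Hopf algebra iff it is linear and f(ab) is a finite
   sum of products of linear functionals of a and of b; by dual_comul_ex these
   can then be taken in the dual Hopf algebra itself. *)
Definition in_dual (f : A -> C) : bool :=
  `[< scalar f /\ exists s : seq ({scalar A} * {scalar A}),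
        forall a b, f (a * b) = \sum_(p <- s) p.1 a * p.2 b >].

Record dual := Dual { dfun :> A -> C; dfunP : in_dual dfun }.

HB.instance Definition _ := [isSub for dfun].
HB.instance Definition _ := [Choice of dual by <:].

Lemma dual_ext (f g : dual) : f =1 g -> f = g.
Proof. by move=> fg; apply: val_inj; apply/funext. Qed.

Lemma dual_scalar (f : dual) : scalar f.
Proof. by case: f => f /= /asboolP[]. Qed.

HB.instance Definition _ (f : dual) :=
  GRing.isLinear.Build C A C *%R (dfun f) (dual_scalar f).

Lemma dual_dec (f : dual) : exists s : seq ({scalar A} * {scalar A}),
  forall a b, f (a * b) = \sum_(p <- s) p.1 a * p.2 b.
Proof. by case: f => f /= /asboolP[]. Qed.

Definition mk_scalar (f : A -> C) (fL : scalar f) : {scalar A} :=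
  HB.pack f (GRing.isLinear.Build C A C *%R f fL).

Lemma in_dual0 : in_dual (fun=> 0).
Proof.
apply/asboolP; split; first by move=> c a b; rewrite mulr0 addr0.
by exists [::] => a b; rewrite big_nil.
Qed.

Lemma in_dualD (f g : dual) : in_dual (fun a => f a + g a).
Proof.
apply/asboolP; split; first by move=> c a b; rewrite !linearP mulrDr addrACA.
have [s hs] := dual_dec f; have [t ht] := dual_dec g.
by exists (s ++ t) => a b; rewrite big_cat hs ht.
Qed.

Lemma scaled_scalar c (f : {scalar A}) : scalar (fun a => c * f a).
Proof. by move=> k a b; rewrite linearP mulrDr mulrCA. Qed.

Lemma in_dualZ c (f : dual) : in_dual (fun a => c * f a).
Proof.
apply/asboolP; split; first exact: scaled_scalar.
have [s hs] := dual_dec f.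
exists [seq (mk_scalar (scaled_scalar c p.1), p.2) | p <- s] => a b.
by rewrite hs big_map mulr_sumr; apply: eq_bigr => p _; rewrite mulrA.
Qed.

Lemma in_dualN (f : dual) : in_dual (fun a => - f a).
Proof.
by have := in_dualZ (-1) f; congr in_dual; apply/funext => a; rewrite mulN1r.
Qed.

Definition dadd f g := Dual (in_dualD f g).
Definition dopp f := Dual (in_dualN f).
Definition dscale c f := Dual (in_dualZ c f).

Lemma daddA : associative dadd.
Proof. by move=> f g h; apply: dual_ext => a /=; rewrite addrA. Qed.
Lemma daddC : commutative dadd.
Proof. by move=> f g; apply: dual_ext => a /=; rewrite addrC. Qed.
Lemma dadd0 : left_id (Dual in_dual0) dadd.
Proof. by move=> f; apply: dual_ext => a /=; rewrite add0r. Qed.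
Lemma daddN : left_inverse (Dual in_dual0) dopp dadd.
Proof. by move=> f; apply: dual_ext => a /=; rewrite addNr. Qed.

HB.instance Definition _ := GRing.isZmodule.Build dual daddA daddC dadd0 daddN.

Lemma dscaleA a b f : dscale a (dscale b f) = dscale (a * b) f.
Proof. by apply: dual_ext => x /=; rewrite mulrA. Qed.
Lemma dscale1 : left_id 1 dscale.
Proof. by move=> f; apply: dual_ext => a /=; rewrite mul1r. Qed.
Lemma dscaleDr : right_distributive dscale +%R.
Proof. by move=> c f g; apply: dual_ext => a /=; rewrite mulrDr. Qed.
Lemma dscaleDl f : {morph dscale^~ f : a b / a + b}.
Proof. by move=> a b; apply: dual_ext => x /=; rewrite mulrDl. Qed.

HB.instance Definition _ :=
  GRing.Zmodule_isLmodule.Build C dual dscaleA dscale1 dscaleDr dscaleDl.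

Lemma dualDE (f g : dual) a : (f + g) a = f a + g a. Proof. by []. Qed.
Lemma dualZE c (f : dual) a : (c *: f) a = c * f a. Proof. by []. Qed.
Lemma dual0E a : (0 : dual) a = 0. Proof. by []. Qed.
Lemma dual_sumE I (r : seq I) (F : I -> dual) a :
  (\sum_(i <- r) F i) a = \sum_(i <- r) F i a.
Proof. by elim/big_rec2: _ => // i x f _ <-. Qed.

Lemma dualfD (f : dual) a b : f (a + b) = f a + f b.
Proof. exact: raddfD. Qed.
Lemma dualfZ (f : dual) c a : f (c *: a) = c * f a.
Proof. exact: linearZ. Qed.

Lemma prod_bal (f g : {scalar A}) : balanced (fun x y => f x * g y).
Proof.
split=> *; rewrite ?raddfD ?mulrDl ?mulrDr // !linearZ /=.
by rewrite mulrCA mulrA.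
Qed.

Lemma prod_bal_dual (f g : dual) : balanced (fun x y => f x * g y).
Proof. exact: (prod_bal f g). Qed.

Lemma conv_scalar (f g : {scalar A}) : scalar (fun a => sw a (fun x y => f x * g y)).
Proof.
move=> c a b; rewrite swD ?swZ; try exact: prod_bal.
congr (_ + _); rewrite (sw_comp (h := fun x => c * x)); last first.
  by move=> x y; rewrite mulrDr.
by apply: eq_sw => x y; rewrite linearZ /= mulrA.
Qed.

Lemma in_dualM (f g : dual) : in_dual (fun a => sw a (fun x y => f x * g y)).
Proof.
apply/asboolP; split; first exact: (conv_scalar f g).
have [s hs] := dual_dec f; have [t ht] := dual_dec g.
exists [seq (mk_scalar (conv_scalar p.1 q.1), mk_scalar (conv_scalar p.2 q.2)) |
  p <- s, q <- t] => a b.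
rewrite swM; last exact: prod_bal_dual.
rewrite big_allpairs_dep /=.
transitivity (\sum_(p <- s) \sum_(q <- t) sw a (fun x y => sw b (fun u v =>
   p.1 x * p.2 u * (q.1 y * q.2 v)))).
  under [RHS]eq_bigr => p _ do rewrite -sw_sum.
  rewrite -sw_sum; apply: eq_sw => x y.
  under [RHS]eq_bigr => p _ do rewrite -sw_sum.
  rewrite -sw_sum; apply: eq_sw => u v.
  by rewrite hs ht mulr_suml; apply: eq_bigr => p _; rewrite mulr_sumr.
apply: eq_bigr => p _; apply: eq_bigr => q _.
rewrite (sw_comp (h := fun z => z * _)) => [|x y]; last by rewrite mulrDl.
apply: eq_sw => x y.
rewrite (sw_comp (h := fun z => _ * z)) => [|u v]; last by rewrite mulrDr.
by apply: eq_sw => u v; rewrite mulrACA.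
Qed.

Lemma in_dual1 : in_dual (@counit C A).
Proof.
apply/asboolP; split; first exact: counit_scalar.
by exists [:: (@counit C A : {scalar A}, @counit C A : {scalar A})] => a b;
  rewrite big_seq1 counitM.
Qed.

Lemma star_scalar (f : {scalar A}) : scalar (fun a => (f (star (S a)))^*).
Proof.
move=> c a b; rewrite linearP starD starZ linearP rmorphD rmorphM /=.
by rewrite conjCK.
Qed.

Lemma in_dual_star (f : dual) : in_dual (fun a => (f (star (S a)))^*).
Proof.
apply/asboolP; split; first exact: (star_scalar f).
have [s hs] := dual_dec f.
exists [seq (mk_scalar (star_scalar p.1), mk_scalar (star_scalar p.2)) |
  p <- s] => a b.
rewrite antipodeM starM hs big_map /=.
rewrite rmorph_sum; apply: eq_bigr => p _.
by rewrite rmorphM.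
Qed.

Definition dmul f g := Dual (in_dualM f g).
Definition dunit := Dual in_dual1.
Definition dstar f := Dual (in_dual_star f).

Lemma dmulA : associative dmul.
Proof.
move=> f g h; apply: dual_ext => a /=.
have BT : tribalanced (fun x y z => f x * (g y * h z)).
  by split=> *; rewrite ?raddfD ?linearZ /=; ring.
transitivity (sw a (fun u y => sw y (fun v z => f u * (g v * h z)))).
  by apply: eq_sw => u y; rewrite -sw_comp // => x z; rewrite mulrDr.
rewrite -swA //; apply: eq_sw => x z.
rewrite (sw_comp (h := fun t => t * _)) => [|u v]; last by rewrite mulrDl.
by apply: eq_sw => u v; rewrite mulrA.
Qed.

Lemma dmul1l : left_id dunit dmul.
Proof.
move=> f; apply: dual_ext => a /=.
apply: (@sw_counitl _ _ C^o f) => [x y|c x]; [exact: raddfD|exact: linearZ].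
Qed.

Lemma dmul1r : right_id dunit dmul.
Proof.
move=> f; apply: dual_ext => a /=.
rewrite -[RHS](@sw_counitr _ _ C^o f) => [|x y|c x].
- by apply: eq_sw => x y; rewrite mulrC.
- exact: raddfD.
- exact: linearZ.
Qed.

Lemma dmulDl : left_distributive dmul dadd.
Proof.
move=> f g h; apply: dual_ext => a /=; rewrite -swfD.
by apply: eq_sw => x y; rewrite mulrDl.
Qed.

Lemma dmulDr : right_distributive dmul dadd.
Proof.
move=> f g h; apply: dual_ext => a /=; rewrite -swfD.
by apply: eq_sw => x y; rewrite mulrDr.
Qed.

Lemma dunit_neq0 : dunit != 0.
Proof.
apply/eqP => /(congr1 (fun f : dual => f 1)) /=; rewrite counit1.
by apply/eqP; exact: oner_neq0.
Qed.

HB.instance Definition _ := GRing.Zmodule_isNzRing.Build dual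
  dmulA dmul1l dmul1r dmulDl dmulDr dunit_neq0.

Lemma dscaleAl c (f g : dual) : c *: (f * g) = (c *: f) * g.
Proof.
apply: dual_ext => a /=; rewrite (sw_comp (h := fun x => c * x)).
  by apply: eq_sw => x y; rewrite mulrA.
by move=> x y; rewrite mulrDr.
Qed.

HB.instance Definition _ := GRing.Lmodule_isLalgebra.Build C dual dscaleAl.

Lemma dscaleAr c (f g : dual) : c *: (f * g) = f * (c *: g).
Proof.
apply: dual_ext => a /=; rewrite (sw_comp (h := fun x => c * x)).
  by apply: eq_sw => x y; rewrite mulrCA.
by move=> x y; rewrite mulrDr.
Qed.

HB.instance Definition _ := GRing.Lalgebra_isAlgebra.Build C dual dscaleAr.

Lemma dstarK : involutive dstar.
Proof. by move=> f; apply: dual_ext => a /=; rewrite star_antipodeK conjCK. Qed.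

Lemma dstarD : {morph dstar : f g / f + g}.
Proof. by move=> f g; apply: dual_ext => a /=; rewrite rmorphD. Qed.

Lemma dstarZ c f : dstar (c *: f) = c^* *: dstar f.
Proof. by apply: dual_ext => a /=; rewrite rmorphM. Qed.

Lemma dstarM f g : dstar (f * g) = dstar g * dstar f.
Proof.
apply: dual_ext => a /=; rewrite sw_star; last exact: prod_bal_dual.
rewrite sw_antipode; last first.
  by split=> *; rewrite ?starD ?starZ ?raddfD ?linearZ /=; ring.
rewrite (sw_comp (h := fun x => x^*)) => [|x y]; last exact: rmorphD.
by apply: eq_sw => x y; rewrite rmorphM mulrC.
Qed.

HB.instance Definition _ := Algebra_isStarAlgebra.Build C dual
  dstarK dstarD dstarZ dstarM.

Lemma dualME (f g : dual) a : (f * g) a = sw a (fun x y => f x * g y).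
Proof. by []. Qed.

Lemma dual1E a : (1 : dual) a = counit a.
Proof. by []. Qed.

Lemma dual_starE (f : dual) a : star f a = (f (star (S a)))^*.
Proof. by []. Qed.

Lemma eval_bal (V : lmodType C) a : balanced (fun (v : V) (f : dual) => f a *: v).
Proof.
split=> *; rewrite ?dualDE ?dualZE ?scalerDr ?scalerDl // scalerA.
by rewrite mulrC.
Qed.

Lemma tensor_dual_eq0 (V : lmodType C) (t : tensor V dual) :
  (forall a, tlift (fun v (f : dual) => f a *: v) t = 0) -> t = 0.
Proof.
have [n [v [g ->]]] : exists n (v : 'I_n -> V) (g : 'I_n -> dual),
    t = \sum_i v i \ox g i.
  exists (size (repr t)), (fun i => (tnth (in_tuple (repr t)) i).1),
    (fun i => (tnth (in_tuple (repr t)) i).2).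
  by rewrite {1}[t]tensor_sum big_tnth.
move=> h.
have [m [a [P hP]]] := rank_points (fun i a => g i a).
have gE k : g k = \sum_k' (\sum_l P k' l * g k (a l)) *: g k'.
  apply: dual_ext => x; rewrite dual_sumE (hP k x); apply: eq_bigr => k' _.
  by rewrite dualZE mulrC.
transitivity (\sum_k' (\sum_l P k' l *: \sum_k g k (a l) *: v k) \ox g k').
  transitivity (\sum_k \sum_k' (\sum_l P k' l * g k (a l)) *: v k \ox g k').
    apply: eq_bigr => k _; rewrite [in LHS](gE k).
    rewrite tens_sumr.
    by apply: eq_bigr => k' _; rewrite tensZr tensZl.
  rewrite exchange_big /=; apply: eq_bigr => k' _.
  rewrite -tens_suml; congr (_ \ox _).
  under [RHS]eq_bigr => l _ do rewrite scaler_sumr.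
  rewrite exchange_big /=; apply: eq_bigr => k _; rewrite scaler_suml.
  by apply: eq_bigr => l _; rewrite scalerA.
apply: big1 => k' _; rewrite big1 ?tens0l // => l _; have := h (a l); rewrite tlift_sum; last exact: eval_bal.
under eq_bigr => k _ do rewrite (tliftE (eval_bal _ _)).
by move=> ->; rewrite scaler0.
Qed.

Definition dual_pair (t : tensor dual dual) (a b : A) : C :=
  tlift (fun f g : dual => f a * g b) t.

Lemma dual_pair_bal (a b : A) : balanced (fun f g : dual => f a * g b).
Proof. by split=> *; rewrite ?dualDE ?dualZE; ring. Qed.

Lemma dual_pairD s t a b : dual_pair (s + t) a b = dual_pair s a b + dual_pair t a b.
Proof. exact: tliftD (dual_pair_bal a b) _ _. Qed.

Lemma dual_pairZ c t a b : dual_pair (c *: t) a b = c * dual_pair t a b.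
Proof.
rewrite /dual_pair tliftfZ; last exact: dual_pair_bal.
rewrite (tlift_comp (h := fun x => c * x)) => [|x y]; last by rewrite mulrDr.
by apply: eq_tlift => f g; rewrite dualZE mulrA.
Qed.

Lemma dual_pairE (f g : dual) a b : dual_pair (f \ox g) a b = f a * g b.
Proof. exact: tliftE (dual_pair_bal a b) _ _. Qed.

Lemma dual_pair_inj s t : (forall a b, dual_pair s a b = dual_pair t a b) -> s = t.
Proof.
move=> h; apply/eqP; rewrite -subr_eq0; apply/eqP.
apply: tensor_dual_eq0 => b; apply: dual_ext => a.
rewrite (tlift_comp (h := fun f : dual => f a)) //.
transitivity (dual_pair (s - t) a b).
  by apply: eq_tlift => f g; rewrite dualZE mulrC.
by rewrite -scaleN1r dual_pairD dual_pairZ h mulN1r subrr.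
Qed.

Lemma translate_scalar (f : dual) a : scalar (fun b => f (a * b)).
Proof. by move=> c x y; rewrite mulrDr -scalerAr linearP. Qed.

Lemma translater_scalar (f : dual) b : scalar (fun a => f (a * b)).
Proof. by move=> c x y; rewrite mulrDl -scalerAl linearP. Qed.

Lemma in_dual_translate (f : dual) a : in_dual (fun b => f (a * b)).
Proof.
apply/asboolP; split; first exact: translate_scalar.
have [s hs] := dual_dec f.
have pL (p : {scalar A}) : scalar (fun b => p (a * b)).
  by move=> c x y; rewrite mulrDr -scalerAr linearP.
exists [seq (mk_scalar (pL p.1), p.2) | p <- s] => x y.
by rewrite mulrA hs big_map.
Qed.

Lemma in_dual_translater (f : dual) b : in_dual (fun a => f (a * b)).
Proof.
apply/asboolP; split; first exact: translater_scalar.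
have [s hs] := dual_dec f.
have pL (p : {scalar A}) : scalar (fun x => p (x * b)).
  by move=> c x y; rewrite mulrDl -scalerAl linearP.
exists [seq (p.1, mk_scalar (pL p.2)) | p <- s] => x y.
by rewrite -mulrA hs big_map.
Qed.

Lemma dual_comul_ex (f : dual) :
  exists t : tensor dual dual, forall a b, dual_pair t a b = f (a * b).
Proof.
have [s hs] := dual_dec f.
pose g i : A -> C := (tnth (in_tuple s) i).1.
pose h i : A -> C := (tnth (in_tuple s) i).2.
have {}hs a b : f (a * b) = \sum_(i < size s) g i a * h i b.
  by rewrite hs big_tnth.
have [m [x [P hP]]] := rank_points g.
pose h' k : dual := \sum_(l < m) P k l *: Dual (in_dual_translate f (x l)).
have {}hs a b : f (a * b) = \sum_(i < size s) g i a * h' i b.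
  rewrite hs; under eq_bigr => k _ do rewrite hP mulr_suml.
  rewrite exchange_big /=; apply: eq_bigr => k' _.
  rewrite dual_sumE; under eq_bigr => k _ do rewrite -mulrA.
  rewrite -mulr_sumr; congr (_ * _); under eq_bigr => k _ do rewrite mulr_suml.
  rewrite exchange_big /=; apply: eq_bigr => l _.
  rewrite ?dualZE /= hs mulr_sumr; apply: eq_bigr => k _; by rewrite mulrA.
have [m' [y [Q hQ]]] := rank_points (fun i b => h' i b).
pose g' k : dual := \sum_(l < m') Q k l *: Dual (in_dual_translater f (y l)).
exists (\sum_(k < size s) g' k \ox h' k) => a b.
rewrite /dual_pair tlift_sum; last exact: dual_pair_bal.
under eq_bigr => k _ do rewrite (tliftE (dual_pair_bal a b)).
rewrite hs; under [RHS]eq_bigr => k _ do rewrite hQ mulr_sumr.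
rewrite [RHS]exchange_big /=; apply: eq_bigr => k' _.
under [RHS]eq_bigr => k _ do rewrite mulrCA.
rewrite -mulr_sumr mulrC; congr (_ * _); rewrite dual_sumE.
under [RHS]eq_bigr => k _ do rewrite mulr_sumr.
rewrite [RHS]exchange_big /=; apply: eq_bigr => l _.
rewrite ?dualZE /= hs mulr_sumr; apply: eq_bigr => k _; by rewrite mulrCA.
Qed.

(* The coproduct dual to the product of A: the unique tensor of
   functionals with <dcomul f, a \ox b> = f(ab). *)
Definition dcomul (f : dual) : tensor dual dual := projT1 (cid (dual_comul_ex f)).

Lemma dcomulE f a b : dual_pair (dcomul f) a b = f (a * b).
Proof. by rewrite /dcomul; case: cid. Qed.

Lemma dcomul_uniq (f : dual) t : (forall a b, dual_pair t a b = f (a * b)) -> dcomul f = t.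
Proof. by move=> h; apply: dual_pair_inj => a b; rewrite dcomulE h. Qed.

End Dual.

Reserved Notation "f |> a" (at level 40, left associativity).

Section CrossProduct.
Variables (C : numClosedFieldType) (A : hopfStarAlgType C).
Local Notation dual := (dual A).
Local Notation S := (@antipode C A).
Local Notation T := (@cantipode C A).

(* f |> a = a_(1) <f, a_(2)> *)
Definition dact (f : dual) (a : A) : A := sw a (fun x y => f y *: x).
Local Notation "f |> a" := (dact f a).

Lemma dact_bal (f : dual) : balanced (fun x y : A => f y *: x).
Proof.
split=> *; rewrite ?raddfD ?scalerDr ?scalerDl // dualfZ scalerA.
by rewrite mulrC.
Qed.

Lemma dactDr (f : dual) : {morph dact f : a b / a + b}.
Proof. by move=> a b; apply: swD; exact: dact_bal. Qed.

Lemma dactZr (f : dual) c a : f |> (c *: a) = c *: (f |> a).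
Proof.
rewrite /dact swZ; last exact: dact_bal.
by rewrite sw_scale; apply: eq_sw => x y; rewrite !scalerA mulrC.
Qed.

Lemma dactDl (f g : dual) a : (f + g) |> a = f |> a + g |> a.
Proof. by rewrite -swfD; apply: eq_sw => x y; rewrite scalerDl. Qed.

Lemma dactZl c (f : dual) a : (c *: f) |> a = c *: (f |> a).
Proof. by rewrite /dact sw_scale; apply: eq_sw => x y; rewrite scalerA. Qed.

Lemma dact1l a : 1 |> a = a.
Proof. exact: counitr. Qed.

Lemma dact1r (f : dual) : f |> 1 = f 1 *: 1.
Proof. by rewrite /dact sw1 //; exact: dact_bal. Qed.

Lemma dactM (f g : dual) a : (f * g) |> a = f |> (g |> a).
Proof.
have BT : tribalanced (fun x y z : A => (f y * g z) *: x).
  split=> *; rewrite ?raddfD ?mulrDl ?mulrDr ?scalerDl ?scalerDr // ?dualfZ ?scalerA; congr (_ *: _); ring.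
transitivity (sw a (fun x m => sw m (fun y z => (f y * g z) *: x))).
  apply: eq_sw => x m; rewrite dualME.
  by rewrite (sw_comp (h := fun c => c *: x)) // => c c'; rewrite scalerDl.
rewrite -swA // /(dact g) sw_comp; last exact: dactDr.
apply: eq_sw => m z; rewrite dactZr /dact sw_scale.
by apply: eq_sw => x y; rewrite scalerA mulrC.
Qed.

Lemma dact_mul_bal (a b : A) :
  balanced (fun f g : dual => (f |> a) * (g |> b)).
Proof.
split=> *; rewrite ?dactDl ?mulrDl ?mulrDr // !dactZl.
by rewrite -scalerAl -scalerAr.
Qed.

Lemma dact_mul (f : dual) a b :
  f |> (a * b) = tlift (fun f1 f2 : dual => (f1 |> a) * (f2 |> b)) (dcomul f).
Proof.
rewrite /dact swM; last exact: dact_bal.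
transitivity (sw a (fun x y => sw b (fun u v =>
    tlift (fun f1 f2 : dual => (f1 y *: x) * (f2 v *: u)) (dcomul f)))).
  apply: eq_sw => x y; apply: eq_sw => u v; rewrite -dcomulE /dual_pair.
  rewrite (tlift_comp (h := fun c => c *: (x * u))) => [|c c'].
    by apply: eq_tlift => f1 f2; pullZ; rewrite scalerA mulrC.
  by rewrite scalerDl.
rewrite /sw; under eq_tlift => x y do rewrite tlift_swap.
rewrite tlift_swap; apply: eq_tlift => f1 f2.
rewrite -!/(sw _ _) sw_mulr; apply: eq_sw => x y; rewrite sw_mull.
by apply: eq_sw => u v.
Qed.

Definition crossprod := tensor A dual.
HB.instance Definition _ := GRing.Lmodule.on crossprod.

(* (b \ox f)(a \ox g) = b(f_(1) |> a) \ox f_(2)g *)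
Definition cpmul (x y : crossprod) : crossprod :=
  tlift (fun b f => tlift (fun a g =>
    tlift (fun f1 f2 => (b * (f1 |> a)) \ox (f2 * g)) (dcomul f)) y) x.

(* (af)^* = f^* a^* *)
Definition cpstar (x : crossprod) : crossprod :=
  tlift (fun a f => cpmul (1 \ox star f) (star a \ox 1)) x.

(* The action of the cross product on A, used to check its axioms. *)
Definition cpact (x : crossprod) (c : A) : A :=
  tlift (fun a (f : dual) => a * (f |> c)) x.

Lemma cpact_bal c : balanced (fun a (f : dual) => a * (f |> c)).
Proof.
split=> *; rewrite ?dactDl ?mulrDl ?mulrDr // !dactZl.
by rewrite -scalerAl -scalerAr.
Qed.

Lemma cpactDl c x y : cpact (x + y) c = cpact x c + cpact y c.
Proof. exact: tliftD (cpact_bal c) _ _. Qed.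

Lemma cpactDr x : {morph cpact x : a b / a + b}.
Proof.
move=> a b; rewrite -tliftfD; apply: eq_tlift => v f.
by rewrite dactDr mulrDr.
Qed.

Lemma cpactE a (f : dual) c : cpact (a \ox f) c = a * (f |> c).
Proof. exact: tliftE (cpact_bal c) _ _. Qed.

Lemma cpact_inj x y : cpact x =1 cpact y -> x = y.
Proof.
move=> h; have {}h c : cpact (x - y) c = 0.
  by apply: (addIr (cpact y c)); rewrite -cpactDl subrK h add0r.
apply/eqP; rewrite -subr_eq0; apply/eqP; move: (x - y : crossprod) h => z h.
apply: tensor_dual_eq0 => c.
transitivity (sw c (fun p q => cpact z q * T p)); last first.
  under eq_sw => p q do rewrite h mul0r.
  by rewrite /sw /tlift big1.
rewrite /cpact /sw.
under [RHS]eq_tlift => p q.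
  rewrite (tlift_comp (h := fun u => u * T p)) => [|u v]; last by rewrite mulrDl.
  over.
rewrite tlift_swap; apply: eq_tlift => a f.
have BT : tribalanced (fun p u v => f v *: (a * (u * T p))).
  split=> *; rewrite ?cantipodeD ?dualfD ?mulrDl ?mulrDr ?scalerDl ?scalerDr //.
    by rewrite cantipodeZ; pullZ.
  by rewrite dualfZ; pullZ; rewrite scalerA mulrC.
transitivity (sw c (fun p q => sw q (fun u v => f v *: (a * (u * T p)))));
    last first.
  apply: eq_sw => p q; rewrite sw_mull sw_mulr; apply: eq_sw => u v.
  by pullZ; rewrite mulrA.
rewrite -swA //.
transitivity (sw c (fun m v => counit m *: (f v *: a))).
  rewrite (@sw_counitl _ _ _ (fun v => f v *: a)) // => [u v|k u].
    by rewrite dualfD scalerDl.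
  by rewrite dualfZ scalerA.
apply: eq_sw => m v.
have := sw_cantipoder m => /(congr1 (fun t => f v *: (a * t))).
rewrite -scalerAr mulr1 scalerA mulrC -scalerA => <-.
rewrite sw_mull sw_scale; apply: eq_sw => p u.
by [].
Qed.

Lemma cpmul_bal1 (b : A) (f : dual) (a : A) (g : dual) :
  balanced (fun f1 f2 : dual => (b * (f1 |> a)) \ox (f2 * g)).
Proof.
split=> *; rewrite ?dactDl ?mulrDl ?mulrDr ?tensDl ?tensDr //.
by rewrite dactZl; pullZ.
Qed.

Lemma cpmul_bal2 (b : A) (f : dual) : balanced (fun (a : A) (g : dual) =>
  tlift (fun f1 f2 => (b * (f1 |> a)) \ox (f2 * g)) (dcomul f)).
Proof.
split=> *; rewrite -?tliftfD; apply: eq_tlift => f1 f2.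
- by rewrite dactDr mulrDr tensDl.
- by rewrite mulrDr tensDr.
- by rewrite dactZr; pullZ.
Qed.

Lemma dcomulD (f g : dual) : dcomul (f + g) = dcomul f + dcomul g.
Proof. by apply: dcomul_uniq => a b; rewrite dual_pairD !dcomulE. Qed.

Lemma dcomulZ c (f : dual) : dcomul (c *: f) = c *: dcomul f.
Proof. by apply: dcomul_uniq => a b; rewrite dual_pairZ !dcomulE. Qed.

Lemma cpmul_bal3 (y : crossprod) : balanced (fun (b : A) (f : dual) =>
  tlift (fun a g =>
    tlift (fun f1 f2 => (b * (f1 |> a)) \ox (f2 * g)) (dcomul f)) y).
Proof.
split=> [b b' f|b f f'|c b f]; rewrite -?tliftfD; apply: eq_tlift => a g.
- by rewrite -tliftfD; apply: eq_tlift => f1 f2; rewrite mulrDl tensDl.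
- by rewrite dcomulD (tliftD (cpmul_bal1 b f a g)).
- rewrite dcomulZ (tliftfZ _ _ (cpmul_bal1 b f a g)).
  by apply: eq_tlift => f1 f2; rewrite dactZl; pullZ.
Qed.

Lemma cpmulE b f a g : cpmul (b \ox f) (a \ox g) =
  tlift (fun f1 f2 => (b * (f1 |> a)) \ox (f2 * g)) (dcomul f).
Proof. by rewrite /cpmul (tliftE (cpmul_bal3 _)) (tliftE (cpmul_bal2 b f)). Qed.

Lemma cpmulDl : left_distributive cpmul +%R.
Proof. by move=> x y z; exact: tliftD (cpmul_bal3 z) _ _. Qed.

Lemma cpmulDr : right_distributive cpmul +%R.
Proof.
move=> x y z; rewrite -tliftfD; apply: eq_tlift => b f.
exact: tliftD (cpmul_bal2 b f) _ _.
Qed.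

Lemma cpactM x y c : cpact (cpmul x y) c = cpact x (cpact y c).
Proof.
move: x; apply: tensor_ext => [x x'|x x'|b f].
- by rewrite cpmulDl cpactDl.
- by rewrite cpactDl.
move: y; apply: tensor_ext => [y y'|y y'|a g].
- by rewrite cpmulDr cpactDl.
- by rewrite cpactDl cpactDr.
rewrite cpmulE !cpactE dact_mul (tlift_comp (h := fun z => cpact z c)) => [|z z'].
  rewrite (tlift_comp (h := fun z => b * z)) => [|z z']; last by rewrite mulrDr.
  by apply: eq_tlift => f1 f2; rewrite cpactE dactM mulrA.
exact: cpactDl.
Qed.

Definition cpone : crossprod := 1 \ox 1.

Lemma cpact1 c : cpact cpone c = c.
Proof. by rewrite cpactE mul1r dact1l. Qed.

Lemma cpmulA : associative cpmul.
Proof. by move=> x y z; apply: cpact_inj => c; rewrite !cpactM. Qed.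

Lemma cpmul1l : left_id cpone cpmul.
Proof. by move=> x; apply: cpact_inj => c; rewrite cpactM cpact1. Qed.

Lemma cpmul1r : right_id cpone cpmul.
Proof. by move=> x; apply: cpact_inj => c; rewrite cpactM cpact1. Qed.

Lemma cpone_neq0 : cpone != 0.
Proof.
apply/eqP => /(congr1 (fun x => cpact x 1)); rewrite cpact1.
have -> : cpact 0 1 = 0 by exact: tlift0 (cpact_bal 1).
by apply/eqP; exact: oner_neq0.
Qed.

HB.instance Definition _ := GRing.Zmodule_isNzRing.Build crossprod
  cpmulA cpmul1l cpmul1r cpmulDl cpmulDr cpone_neq0.

Lemma cpactZ k x c : cpact (k *: x) c = k *: cpact x c.
Proof.
rewrite /cpact (tliftfZ _ _ (cpact_bal c)) tlift_comp => [|u v].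
  by apply: eq_tlift => a f; rewrite scalerAl.
by rewrite scalerDr.
Qed.

Lemma cpscaleAl k (x y : crossprod) : k *: (x * y) = (k *: x) * y.
Proof. by apply: cpact_inj => c; rewrite cpactZ !cpactM cpactZ. Qed.

HB.instance Definition _ := GRing.Lmodule_isLalgebra.Build C crossprod cpscaleAl.

Lemma cpactZr k x c : cpact x (k *: c) = k *: cpact x c.
Proof.
rewrite /cpact [RHS]tlift_comp => [|u v]; last by rewrite scalerDr.
by apply: eq_tlift => a f; rewrite dactZr -scalerAr.
Qed.

Lemma cpscaleAr k (x y : crossprod) : k *: (x * y) = x * (k *: y).
Proof. by apply: cpact_inj => c; rewrite cpactZ !cpactM cpactZ cpactZr. Qed.

HB.instance Definition _ := GRing.Lalgebra_isAlgebra.Build C crossprod cpscaleAr.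

Definition alg_in (a : A) : crossprod := a \ox 1.
Definition dual_in (f : dual) : crossprod := 1 \ox f.

Lemma cpact_alg a c : cpact (alg_in a) c = a * c.
Proof. by rewrite cpactE dact1l. Qed.

Lemma cpact_dual f c : cpact (dual_in f) c = f |> c.
Proof. by rewrite cpactE mul1r. Qed.

Lemma alg_inM a b : alg_in (a * b) = alg_in a * alg_in b.
Proof. by apply: cpact_inj => c; rewrite cpactM !cpact_alg mulrA. Qed.

Lemma dual_inM f g : dual_in (f * g) = dual_in f * dual_in g.
Proof. by apply: cpact_inj => c; rewrite cpactM !cpact_dual dactM. Qed.

Lemma alg_dual_in a f : alg_in a * dual_in f = a \ox f.
Proof.
by apply: cpact_inj => c; rewrite cpactM cpact_alg cpact_dual cpactE.
Qed.

Lemma cpstar_bal : balanced (fun (a : A) (f : dual) =>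
  dual_in (star f) * alg_in (star a)).
Proof.
split=> [a a' f|a f f'|k a f].
- by rewrite -mulrDr starD /alg_in tensDl.
- by rewrite -mulrDl starD /dual_in tensDr.
- by rewrite !starZ /alg_in /dual_in tensZl tensZr; pullZ.
Qed.

Lemma cpstarE a f : cpstar (a \ox f) = dual_in (star f) * alg_in (star a).
Proof. exact: tliftE cpstar_bal _ _. Qed.

Lemma cpstarD : {morph cpstar : x y / x + y}.
Proof. exact: tliftD cpstar_bal. Qed.

Lemma cpstarZ k x : cpstar (k *: x) = k^* *: cpstar x.
Proof.
rewrite /cpstar (tliftfZ _ _ cpstar_bal) [RHS]tlift_comp => [|u v].
  apply: eq_tlift => a f; rewrite starZ /alg_in tensZl.
  by rewrite -[LHS]/(dual_in _ * (_ *: alg_in _)) -scalerAr.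
by rewrite scalerDr.
Qed.

Lemma dact_starE (f : dual) c :
  star f |> c = sw c (fun p q => (f (star (S q)))^* *: p).
Proof. by []. Qed.

Lemma sw_tlift (V W : lmodType C) (X : zmodType) (G : A -> A -> V -> W -> X) a t :
  sw a (fun x y => tlift (G x y) t) = tlift (fun v w => sw a (fun x y => G x y v w)) t.
Proof. exact: tlift_swap. Qed.

Lemma dact_star_mul (f : dual) x c : star f |> (star x * c) =
  sw x (fun u v => sw c (fun p q =>
    (f (T v * star (S q)))^* *: (star u * p))).
Proof.
have fB : balanced (fun p q => (star f) q *: p) := dact_bal (star f).
rewrite {1}/dact swM // sw_star; last first.
  split=> [z z' w|z w w'|k z w]; rewrite -?swfD; try apply: eq_sw => p q.
  - by rewrite mulrDl scalerDr.
  - by rewrite mulrDl dualfD scalerDl.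
  - by pullZ; rewrite ?dualfZ !scalerA mulrC.
apply: eq_sw => u v; apply: eq_sw => p q.
by rewrite dual_starE antipodeM starM.
Qed.

Lemma cpstar_cross a f :
  cpstar (dual_in f * alg_in a) = alg_in (star a) * dual_in (star f).
Proof.
apply: cpact_inj => c; rewrite cpactM cpact_alg cpact_dual.
rewrite [dual_in f * _]cpmulE (tlift_comp _ _ cpstarD).
rewrite (tlift_comp (h := fun z => cpact z c)) => [|z z']; last exact: cpactDl.
transitivity (sw a (fun x y => sw x (fun u v => sw c (fun p q =>
    (f (y * (T v * star (S q))))^* *: (star u * p))))).
  transitivity (tlift (fun f1 f2 : dual => sw a (fun x y => sw x (fun u v =>
      sw c (fun p q => (f1 y * f2 (T v * star (S q)))^* *: (star u * p)))))
      (dcomul f)).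
    apply: eq_tlift => f1 f2.
    rewrite mul1r mulr1 cpstarE cpactM cpact_alg cpact_dual.
    rewrite [f1 |> a]/dact (sw_comp _ _ (@starD C A)) sw_mulr.
    rewrite (sw_comp _ _ (dactDr (star f2))); apply: eq_sw => x y.
    rewrite starZ -scalerAl dactZr dact_star_mul sw_scale; apply: eq_sw => u v.
    by rewrite sw_scale; apply: eq_sw => p q; rewrite scalerA rmorphM.
  rewrite -sw_tlift; apply: eq_sw => x y; rewrite -sw_tlift; apply: eq_sw => u v.
  rewrite -sw_tlift; apply: eq_sw => p q; rewrite -dcomulE /dual_pair.
  rewrite (tlift_comp (h := fun k => k^* *: (star u * p))) // => k k'.
  by rewrite rmorphD scalerDl.
have BT : tribalanced (fun u v y => sw c (fun p q =>
    (f (y * (T v * star (S q))))^* *: (star u * p))).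
  split=> *; rewrite -?swfD; apply: eq_sw => p q;
  rewrite ?starD ?cantipodeD ?mulrDl ?mulrDr ?dualfD ?rmorphD /= ?scalerDl ?scalerDr //.
    by rewrite cantipodeZ starZ; pullZ; rewrite ?dualfZ rmorphM scalerA mulrC.
  by rewrite cantipodeZ; pullZ.
rewrite (swA a BT).
have -> : star a * (star f |> c) = sw a (fun u m =>
    sw c (fun p q => (counit m * f (star (S q)))^* *: (star u * p))).
  transitivity (sw a (fun u m => (star (counit m *: u)) * (star f |> c))).
    rewrite -sw_mulr -(sw_comp _ _ (@starD C A)).
    by congr (star _ * _); rewrite -[LHS](@counitr C A).
  apply: eq_sw => u m; rewrite dact_starE sw_mull; apply: eq_sw => p q.
  by rewrite starZ; pullZ; rewrite scalerA rmorphM mulrC.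
apply: eq_sw => u m; rewrite sw_swap; apply: eq_sw => p q.
rewrite -(sw_comp (h := fun k => k^* *: (star u * p))) => [|k k']; last first.
  by rewrite rmorphD scalerDl.
congr (_^* *: _); rewrite -[in LHS]sw_comp; last by move=> k k'; rewrite dualfD.
under eq_sw => v y do rewrite mulrA.
rewrite -sw_mulr sw_cantipoder -scalerAl mul1r dualfZ.
by [].
Qed.

Lemma star_dual1 : star (1 : dual) = 1.
Proof. by rewrite -[LHS]mulr1 -{2}[1]starK -starM mulr1 starK. Qed.

Lemma cpstar_alg a : cpstar (alg_in a) = alg_in (star a).
Proof. by rewrite cpstarE star_dual1 /dual_in -[_ \ox _]/(1 : crossprod) mul1r. Qed.

Lemma cpstar_dual f : cpstar (dual_in f) = dual_in (star f).
Proof. by rewrite cpstarE star1 /alg_in -[_ \ox _]/(1 : crossprod) mulr1. Qed.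

Lemma cpstarK : involutive cpstar.
Proof.
apply: tensor_ext => [x y|x y|a f] //; first by rewrite !cpstarD.
by rewrite cpstarE cpstar_cross !starK alg_dual_in.
Qed.

Lemma cpstar_sandwich b z g :
  cpstar (alg_in b * z * dual_in g) =
  dual_in (star g) * cpstar z * alg_in (star b).
Proof.
move: z; apply: tensor_ext => [x y|x y|a f].
- by rewrite mulrDr mulrDl cpstarD.
- by rewrite cpstarD mulrDr mulrDl.
rewrite -alg_dual_in !mulrA -alg_inM -mulrA -dual_inM alg_dual_in cpstarE.
by rewrite alg_dual_in cpstarE !starM dual_inM alg_inM !mulrA.
Qed.

Lemma cpstarM x y : cpstar (x * y) = cpstar y * cpstar x.
Proof.
move: x; apply: tensor_ext => [x x'|x x'|b f].
- by rewrite mulrDl cpstarD.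
- by rewrite cpstarD mulrDr.
move: y; apply: tensor_ext => [y y'|y y'|a g].
- by rewrite mulrDr cpstarD.
- by rewrite cpstarD mulrDl.
rewrite -!alg_dual_in mulrA -[alg_in b * _ * _]mulrA cpstar_sandwich.
by rewrite cpstar_cross !alg_dual_in !cpstarE !mulrA -alg_dual_in !mulrA.
Qed.

HB.instance Definition _ := Algebra_isStarAlgebra.Build C crossprod
  cpstarK cpstarD cpstarZ cpstarM.

End CrossProduct.

Notation "f |> a" := (dact f a) : ring_scope.

Section StarSubalgebra.
Variables (C : numClosedFieldType) (T : starAlgType C).

Definition star_subalg (B : {pred T}) : Prop :=
  GRing.subalg_closed B /\ {in B, forall x, star x \in B}.

Definition star_gen (G : {pred T}) : {pred T} :=
  [pred x | `[< forall B : {pred T}, star_subalg B -> {subset G <= B} -> x \in B >]].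

Lemma star_gen_subalg G : star_subalg (star_gen G).
Proof.
split; [split|].
- by apply/asboolP => B [[]].
- move=> c x y /asboolP hx /asboolP hy; apply/asboolP => B hB hG.
  by have [[_ + _] _] := hB; apply; [exact: hx|exact: hy].
- move=> x y /asboolP hx /asboolP hy; apply/asboolP => B hB hG.
  by have [[_ _ +] _] := hB; apply; [exact: hx|exact: hy].
- move=> x /asboolP hx; apply/asboolP => B hB hG.
  by have [_ +] := hB; apply; exact: hx.
Qed.

End StarSubalgebra.

(* The *-subalgebra of the cross product generated by A and U. *)
Definition subcrossprod (C : numClosedFieldType) (A : hopfStarAlgType C)
    (U : {pred dual A}) : {pred crossprod A} :=
  star_gen [pred x | `[< (exists a, x = alg_in a) \/
                         (exists2 f, f \in U & x = dual_in f) >]].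

HB.mixin Record Lmodule_isBimodule (C : numClosedFieldType) (A : algType C) G
    of GRing.Lmodule C G := {
  lact : A -> G -> G;
  ract : G -> A -> G;
  lact_linearl : forall g, linear (lact^~ g);
  lact_linearr : forall a, linear (lact a);
  ract_linearl : forall a, linear (ract^~ a);
  ract_linearr : forall g, linear (ract g);
  lact1 : forall g, lact 1 g = g;
  ract1 : forall g, ract g 1 = g;
  lactM : forall a b g, lact (a * b) g = lact a (lact b g);
  ractM : forall g a b, ract g (a * b) = ract (ract g a) b;
  lractA : forall a g b, ract (lact a g) b = lact a (ract g b) }.

#[short(type="bimodType")]
HB.structure Definition Bimodule (C : numClosedFieldType) (A : algType C) :=
  {G of GRing.Lmodule C G & Lmodule_isBimodule C A G}.

Section Calculus.
Variables (C : numClosedFieldType).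

Record fodc (A : algType C) (G : bimodType A) (d : A -> G) : Prop := Fodc {
  fodc_linear : linear d;
  fodc_leibniz : forall a b, d (a * b) = lact a (d b) + ract (d a) b;
  fodc_span : forall g, exists s : seq (A * A),
    g = \sum_(p <- s) lact p.1 (d p.2) }.

Record star_calculus (A : starAlgType C) (G : bimodType A) (d : A -> G) : Prop :=
  StarCalculus {
  star_calculus_fodc : fodc d;
  star_calculus_star : exists st : G -> G,
    [/\ involutive st,
        forall c g h, st (c *: g + h) = c^* *: st g + st h &
        forall a b c, st (ract (lact a (d b)) c) =
                      ract (lact (star c) (d (star b))) (star a)] }.

(* The product (a \ox b)(a' \ox g) = aa' \ox bg. *)
Definition tact (A : algType C) (G : bimodType A) (s : tensor A A)
    (t : tensor A G) : tensor A G :=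
  tlift (fun a b => tlift (fun a' g => (a * a') \ox lact b g) t) s.

Lemma tactE (A : algType C) (G : bimodType A) (a b a' : A) (g : G) :
  tact (a \ox b) (a' \ox g) = (a * a') \ox lact b g.
Proof.
have lD (c : A) (x y : G) : lact c (x + y) = lact c x + lact c y.
  by rewrite -[x]scale1r lact_linearr !scale1r.
have lDl (x y : A) (h : G) : lact (x + y) h = lact x h + lact y h.
  by rewrite -[x in LHS]scale1r lact_linearl scale1r.
have l0 (c : A) : lact c 0 = 0 :> G by apply: (addrI (lact c 0)); rewrite -lD !addr0.
have l0l (h : G) : lact 0 h = 0 :> G by apply: (addrI (lact 0 h)); rewrite -lDl !addr0.
have lZ k (c : A) (x : G) : lact c (k *: x) = k *: lact c x.
  by rewrite -[k *: x]addr0 lact_linearr l0 addr0.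
have lZl k (c : A) (x : G) : lact (k *: c) x = k *: lact c x.
  by rewrite -[k *: c]addr0 lact_linearl l0l addr0.
rewrite /tact !tliftE //.
  by split=> *; rewrite ?mulrDr ?lD ?tensDl ?tensDr // -scalerAr lZ tensZl tensZr.
split=> [x x' y|x y y'|c x y]; rewrite -?tliftfD; apply: eq_tlift => u v.
- by rewrite mulrDl tensDl.
- by rewrite lDl tensDr.
- by rewrite -scalerAl lZl tensZl tensZr.
Qed.

Variables (A : hopfStarAlgType C) (G : bimodType A) (d : A -> G).

Definition left_coaction (DL : G -> tensor A G) : Prop :=
  linear DL /\
  forall a b, DL (lact a (d b)) = tact (comul a) (tmap id d (comul b)).

Definition left_invariant (DL : G -> tensor A G) (g : G) : Prop :=
  DL g = 1 \ox g.

Definition invariant_basis (DL : G -> tensor A G) n (w : 'I_n -> G) : Prop :=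
  (forall k, left_invariant DL (w k)) /\
  (forall g, left_invariant DL g ->
     exists! c : 'rV[C]_n, g = \sum_k c 0 k *: w k).

Definition associated_functionals n (w : 'I_n -> G)
    (X : 'I_n -> dual A) (f : 'I_n -> 'I_n -> dual A) : Prop :=
  (forall a, d a = \sum_k lact (X k |> a) (w k)) /\
  (forall k a, ract (w k) a = \sum_j lact (f k j |> a) (w j)).

End Calculus.

Section Hilbert.
Variable C : numClosedFieldType.

Definition ipnorm (H : lmodType C) (ip : {dot H for Num.conj}) (h : H) : C :=
  sqrtC (ip h h).

Definition ipcomplete (H : lmodType C) (ip : {dot H for Num.conj}) : Prop :=
  forall u : nat -> H,
  (forall e : C, 0 < e -> exists N, forall p q, (N <= p)%N -> (N <= q)%N ->
     ipnorm ip (u p - u q) < e) ->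
  exists l, forall e : C, 0 < e -> exists N, forall p, (N <= p)%N ->
     ipnorm ip (u p - l) < e.

(* The inner product is linear in its first argument. *)
Record hilbert := Hilbert {
  hilbert_space :> lmodType C;
  ip : {dot hilbert_space for Num.conj};
  ip_complete : ipcomplete ip }.

(* A dense linear subspace of H. *)
Record domain (H : hilbert) := Domain {
  domain_pred : {pred H};
  domain_space :> subLmodType domain_pred;
  domain_dense : forall (h : H) (e : C), 0 < e ->
    exists v : domain_space, ipnorm (ip H) (h - val v) < e }.

Lemma ip_ge0 (H : hilbert) (h : H) : 0 <= ip H h h.
Proof. exact: dnorm_ge0. Qed.

Lemma ipnorm_lt (H : hilbert) (h : H) (e : C) : 0 < e ->
  (ipnorm (ip H) h < e) = (ip H h h < e ^+ 2).
Proof.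
move=> e0; rewrite /ipnorm -{1}[e](sqrCK (ltW e0)) ltr_sqrtC ?nnegrE ?ip_ge0 //.
by rewrite exprn_ge0 // ltW.
Qed.

Section Sum.
Variables (n : nat) (H : hilbert).

Definition ip_sum (f g : {ffun 'I_n -> H}) : C := \sum_i ip H (f i) (g i).

Lemma ip_sum_linearl g : scalar (ip_sum^~ g).
Proof.
move=> c f f'; rewrite /ip_sum mulr_sumr -big_split; apply: eq_bigr => i _ /=.
by rewrite !ffunE linearPl.
Qed.

Lemma ip_sum_linearr f :
  GRing.linear_for (Num.conj \; *%R : C -> C -> C) (ip_sum f).
Proof.
move=> c g g'; rewrite /ip_sum /= mulr_sumr -big_split; apply: eq_bigr => i _ /=.
by rewrite !ffunE linearPr.
Qed.

HB.instance Definition _ := bilinear_isBilinear.Build C {ffun 'I_n -> H}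
  {ffun 'I_n -> H} C *%R (Num.conj \; *%R) ip_sum
  (ip_sum_linearl, ip_sum_linearr).

Lemma ip_sum_herm f g : ip_sum f g = (-1) ^+ false * (ip_sum g f)^*.
Proof.
rewrite expr0 mul1r rmorph_sum; apply: eq_bigr => i _.
by have := hermitian_subproof (f i) (g i) (s := ip H); rewrite expr0 mul1r.
Qed.

HB.instance Definition _ := isHermitianSesquilinear.Build C {ffun 'I_n -> H}
  false Num.conj ip_sum ip_sum_herm.

Lemma ip_sum_gt0 f : f != 0 -> 0 < ip_sum f f.
Proof.
move=> f0; have [i fi0] : exists i, f i != 0.
  apply/existsP; rewrite -[[exists _, _]]negbK; apply: contra f0 => /existsPn h.
  by apply/eqP/ffunP => i; rewrite ffunE; apply/eqP; rewrite -[_ == _]negbK.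
rewrite /ip_sum (bigD1 i) //= ltr_wpDr //.
  by apply: sumr_ge0 => j _; exact: ip_ge0.
exact: neq0_dnorm_gt0.
Qed.

HB.instance Definition _ := isDotProduct.Build C {ffun 'I_n -> H}
  ip_sum ip_sum_gt0.

Lemma ip_sum_le (f : {ffun 'I_n -> H}) i : ip H (f i) (f i) <= ip_sum f f.
Proof.
rewrite /ip_sum (bigD1 i) //= lerDl.
by apply: sumr_ge0 => j _; exact: ip_ge0.
Qed.

Lemma ip_sum_small (f : {ffun 'I_n -> H}) (e : C) : 0 < e ->
    (forall i, ipnorm (ip H) (f i) < e / n.+1%:R) ->
  ipnorm (ip_sum : {dot {ffun 'I_n -> H} for Num.conj}) f < e.
Proof.
move=> e0 fe; have n0 : 0 < n.+1%:R :> C by rewrite ltr0n.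
have : ip_sum f f < e ^+ 2.
  have le i : ip H (f i) (f i) <= e ^+ 2 / n.+1%:R.
    have := fe i; rewrite ipnorm_lt ?divr_gt0 // => /ltW /le_trans; apply.
    rewrite expr_div_n ler_pM2l ?exprn_gt0 // lef_pV2 ?posrE ?exprn_gt0 //.
    by rewrite expr2 ler_peMr ?ler1n // ltW.
  apply: le_lt_trans (ler_sum _ (fun i _ => le i)) _.
  rewrite sumr_const card_ord -(mulr_natr (e ^+ 2 / _)) mulrAC ltr_pdivrMr //.
  by rewrite ltr_pM2l ?exprn_gt0 // ltr_nat.
move=> h; rewrite /ipnorm -[e]sqrCK ?ltW // ltr_sqrtC ?nnegrE //.
by rewrite exprn_ge0 // ltW.
Qed.

Lemma ipnorm_comp (f : {ffun 'I_n -> H}) i :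
  ipnorm (ip H) (f i) <=
  ipnorm (ip_sum : {dot {ffun 'I_n -> H} for Num.conj}) f.
Proof.
by rewrite ler_sqrtC ?nnegrE ?ip_ge0 ?ip_sum_le.
Qed.

Lemma exists_common (Q : 'I_n -> nat -> Prop) :
  (forall i, exists N, forall p, (N <= p)%N -> Q i p) ->
  exists N, forall i p, (N <= p)%N -> Q i p.
Proof.
move=> /choice[N hN]; exists (\max_i N i) => i p hp; apply: hN.
by apply: leq_trans hp; exact: leq_bigmax.
Qed.

Lemma ip_sum_complete :
  ipcomplete (ip_sum : {dot {ffun 'I_n -> H} for Num.conj}).
Proof.
move=> u uC.
have /choice[l hl] : forall i, exists l, forall e : C, 0 < e -> exists N,
    forall p, (N <= p)%N -> ipnorm (ip H) (u p i - l) < e.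
  move=> i; apply: ip_complete => e e0; have [N hN] := uC e e0.
  exists N => p q hp hq; apply: le_lt_trans (hN p q hp hq).
  have -> : u p i - u q i = (u p - u q) i by rewrite !ffunE.
  exact: ipnorm_comp.
exists [ffun i => l i] => e e0.
have e'0 : 0 < e / n.+1%:R by rewrite divr_gt0 // ltr0n.
have [N hN] := exists_common (fun i => hl i _ e'0).
exists N => p hp; apply: ip_sum_small => // i.
by rewrite !ffunE; exact: hN.
Qed.

Definition hilbert_sum : hilbert := Hilbert ip_sum_complete.

End Sum.

Section DomainSum.
Variables (n : nat) (H : hilbert) (D : domain H).

Definition sum_pred : {pred hilbert_sum n H} :=
  [pred h : {ffun 'I_n -> H} | [forall i, h i \in domain_pred D]].

(* The direct sum of n copies of D, inside that of n copies of H. *)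
Definition dsum := {ffun 'I_n -> D}.
HB.instance Definition _ := GRing.Lmodule.on dsum.

Definition dsum_val (v : dsum) : hilbert_sum n H :=
  [ffun i => val (v i)] : {ffun 'I_n -> H}.

Definition dsum_sub (h : hilbert_sum n H) (hP : sum_pred h) : dsum :=
  [ffun i => Sub ((h : {ffun 'I_n -> H}) i) (forallP hP i)].

Lemma dsum_subK h hP : dsum_val (@dsum_sub h hP) = h.
Proof. by apply/ffunP => i; rewrite !ffunE SubK. Qed.

Lemma dsum_rect (K : dsum -> Type) :
  (forall h hP, K (@dsum_sub h hP)) -> forall v, K v.
Proof.
move=> h v; have hP : sum_pred (dsum_val v).
  by apply/forallP => i; rewrite ffunE; exact: valP.
have <- : dsum_sub hP = v; last exact: h.
by apply/ffunP => i; apply: val_inj; rewrite ffunE SubK ffunE.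
Qed.

HB.instance Definition _ := isSub.Build _ sum_pred dsum dsum_rect dsum_subK.

Lemma dsum_valB : {morph dsum_val : v w / v - w}.
Proof. by move=> v w; apply/ffunP => i; rewrite !ffunE raddfB. Qed.

HB.instance Definition _ := GRing.isSubZmodule.Build _ sum_pred dsum dsum_valB.

Lemma dsum_valZ : scalable dsum_val.
Proof. by move=> c v; apply/ffunP => i; rewrite !ffunE linearZ. Qed.

HB.instance Definition _ := GRing.isSubLmodule.Build C _ sum_pred dsum dsum_valZ.

Lemma dsum_dense (h : hilbert_sum n H) (e : C) : 0 < e ->
  exists v : dsum, ipnorm (ip (hilbert_sum n H)) (h - val v) < e.
Proof.
move=> e0; have e'0 : 0 < e / n.+1%:R by rewrite divr_gt0 // ltr0n.
have /choice[v hv] := fun i => domain_dense D ((h : {ffun 'I_n -> H}) i) e'0.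
exists [ffun i => v i]; apply: ip_sum_small => // i.
by rewrite !ffunE; exact: hv.
Qed.

Definition domain_sum : domain (hilbert_sum n H) :=
  @Domain (hilbert_sum n H) sum_pred dsum dsum_dense.

End DomainSum.

Definition dip (H : hilbert) (D : domain H) (v w : D) : C := ip H (val v) (val w).

End Hilbert.

Section Representation.
Variable C : numClosedFieldType.

(* A *-representation of the *-subalgebra B of T; the values of pi outside B
   are irrelevant. *)
Record star_rep (T : starAlgType C) (B : {pred T}) (H : hilbert C)
    (D : domain H) (pi : T -> D -> D) : Prop := StarRep {
  rep_op : {in B, forall x, linear (pi x)};
  rep_linear : {in B &, forall x y, forall c v,
    pi (c *: x + y) v = c *: pi x v + pi y v};
  rep1 : forall v, pi 1 v = v;
  repM : {in B &, forall x y, forall v, pi (x * y) v = pi x (pi y v)};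
  rep_star : {in B, forall x, forall v w,
    dip (pi x v) w = dip v (pi (star x) w)} }.

Definition faithful_rep (T : starAlgType C) (B : {pred T}) (H : hilbert C)
    (D : domain H) (pi : T -> D -> D) : Prop :=
  {in B &, forall x y, pi x =1 pi y -> x = y}.

Section Commutator.
Variables (A : starAlgType C) (G : bimodType A) (d : A -> G).
Variables (H : hilbert C) (E : domain H) (pi : A -> E -> E) (F : E -> E).

Definition commutator_map (tau : G -> E -> E) : Prop :=
  [/\ forall g, linear (tau g),
      forall c g h v, tau (c *: g + h) v = c *: tau g v + tau h v &
      forall a b v,
        tau (lact a (d b)) v = 'i *: pi a (F (pi b v) - pi b (F v))].

Record commutator_rep : Prop := CommutatorRep {
  comm_rep : star_rep predT pi;
  comm_linear : linear F;
  comm_symmetric : forall v w, dip (F v) w = dip v (F w);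
  comm_map : exists tau, commutator_map tau }.

Definition faithful_commutator_rep : Prop :=
  commutator_rep /\
  exists2 tau, commutator_map tau & forall g h, tau g =1 tau h -> g = h.

End Commutator.

Section Construction.
Variables (A : hopfStarAlgType C) (n : nat) (H : hilbert C) (D : domain H).
Variable (pi1 : crossprod A -> D -> D).

Definition sum_rep (a : A) (phi : {ffun 'I_n.+1 -> D}) : {ffun 'I_n.+1 -> D} :=
  [ffun i => pi1 (alg_in a) (phi i)].

Definition sum_op (X : 'I_n -> dual A) (phi : {ffun 'I_n.+1 -> D}) :
    {ffun 'I_n.+1 -> D} :=
  [ffun i => if unlift ord0 i is Some k then pi1 (dual_in (X k)) (phi ord0)
             else \sum_(k < n) pi1 (dual_in (X k)) (phi (lift ord0 k))].

End Construction.

End Representation.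

Arguments sum_rep {C A} n {H D} pi1 a phi.

(* Main.v *)
Require Import Defs.
From HB Require Import structures.
From mathcomp Require Import all_boot all_order all_algebra sesquilinear.
From mathcomp Require Import all_classical all_reals complex.

Set Implicit Arguments.
Unset Strict Implicit.
Unset Printing Implicit Defensive.

Import Order.TTheory GRing.Theory Num.Theory.
Local Open Scope ring_scope.

(** The one-forms w_k form a basis of Gamma as a left A-module
    ([left_coordinates]).  A map from Gamma is therefore determined by the
    coordinates E_k(g) of g = \sum_k E_k(g) w_k, and whatever is defined by
    them is automatically well defined on the expressions a db.

    Comparing coordinates in d(ab) = a db + da b gives the twisted Leibniz rule
      X_j |> (ab) = a (X_j |> b) + \sum_k (X_k |> a) (f^k_j |> b).
    The cross product acts faithfully on A, by multiplication and by |>, and in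
    this action the rule is exactly the commutation relation
      X_j b - b X_j = \sum_k (X_k |> b) f^k_j
    of the cross product ([cross_commutator], [X_twisted_leibniz]).  Hence the
    elements symb_j(g) = \sum_k E_k(g) f^k_j ([symbol]) are linear in g and
    satisfy symb_j(a db) = a (X_j b - b X_j) ([symbol_lact_d]).

    The operator F is an arrowhead matrix: its only nonzero entries are the X_j
    in the first row and in the first column.  Commutators with the diagonal
    operators pi(b), and products with them, are computed entry by entry, so
    a [F, b] is the arrowhead matrix with entries a (X_j b - b X_j), that is,
    symb_j(a db).  So tau(g) is i times the arrowhead matrix with entries
    symb_j(g), and F is symmetric because the X_j are hermitean.

    If pi_1 is faithful, tau(g) determines every symb_j(g).  Since
    w_k 1 = w_k forces f^k_j(1) = delta_kj, the action of symb_j(g) on the unit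
    of A returns E_j(g) ([cpact_symbol1]); so tau(g) determines g. *)

(** * Left modules and tensors *)

Lemma tlift_linear (K : comNzRingType) (V W X : lmodType K) (f : V -> W -> X) :
  balanced f -> (forall c v w, f (c *: v) w = c *: f v w) -> linear (tlift f).
Proof.
move=> fB fZ c s t; rewrite (tliftD fB) (tliftfZ c s fB); congr (_ + _).
rewrite [RHS]tlift_comp => [|x y]; last by rewrite scalerDr.
exact: eq_tlift.
Qed.

Section Bimodule.
Variables (C : numClosedFieldType) (A : algType C) (G : bimodType A).
Implicit Types (a b : A) (g h : G).

HB.instance Definition _ a :=
  GRing.isLinear.Build C G G *:%R (lact a) (lact_linearr a).

Lemma lactDl a b g : lact (a + b) g = lact a g + lact b g.
Proof. by rewrite -[a in LHS]scale1r lact_linearl scale1r. Qed.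

Lemma lact0l g : lact 0 g = 0.
Proof. by apply: (addrI (lact 0 g)); rewrite -lactDl !addr0. Qed.

Lemma lactZl c a g : lact (c *: a) g = c *: lact a g.
Proof. by rewrite -[c *: a]addr0 lact_linearl lact0l addr0. Qed.

Lemma lact_suml I (r : seq I) (F : I -> A) g :
  lact (\sum_(i <- r) F i) g = \sum_(i <- r) lact (F i) g.
Proof. exact: (big_morph (lact^~ g) (fun a b => lactDl a b g) (lact0l g)). Qed.

Lemma tact_balr a b : balanced (fun a' g => (a * a') \ox lact b g).
Proof.
split=> *; rewrite ?mulrDr ?raddfD ?tensDl ?tensDr //.
by rewrite -scalerAr linearZ tensZl tensZr.
Qed.

Lemma tact_ball (t : tensor A G) :
  balanced (fun a b => tlift (fun a' g => (a * a') \ox lact b g) t).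
Proof.
split=> *; rewrite -?tliftfD; apply: eq_tlift => u v.
- by rewrite mulrDl tensDl.
- by rewrite lactDl tensDr.
- by rewrite -scalerAl lactZl tensZl tensZr.
Qed.

Lemma tactDl (s s' : tensor A A) (t : tensor A G) :
  tact (s + s') t = tact s t + tact s' t.
Proof. exact: tliftD (tact_ball t) _ _. Qed.

Lemma tactDr (s : tensor A A) (t t' : tensor A G) :
  tact s (t + t') = tact s t + tact s t'.
Proof.
rewrite -tliftfD; apply: eq_tlift => a b; exact: tliftD (tact_balr a b) _ _.
Qed.

Lemma tactA (s t : tensor A A) (u : tensor A G) :
  tact (tmul s t) u = tact s (tact t u).
Proof.
move: s; apply: tensor_ext => [s s'|s s'|a b]; rewrite ?tmulDl ?tactDl //.
move: t; apply: tensor_ext => [t t'|t t'|a' b'].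
- by rewrite tmulDr tactDl.
- by rewrite tactDl tactDr.
move: u; apply: tensor_ext => [u u'|u u'|a'' g]; rewrite ?tactDr //.
by rewrite tmulE !tactE mulrA lactM.
Qed.

End Bimodule.

(** * Freeness over left-invariant forms *)

Section Coordinates.
Variables (C : numClosedFieldType) (A : hopfStarAlgType C) (G : bimodType A).
Variables (d : A -> G) (DL : G -> tensor A G) (n : nat) (w : 'I_n -> G).
Hypothesis dF : fodc d.
Hypothesis dDL : left_coaction d DL.
Hypothesis wB : invariant_basis DL w.
Hypothesis w_span : forall g, exists c : 'I_n -> A, g = \sum_k lact (c k) (w k).

Local Notation S := (@antipode C A).
Let DL_linear : linear DL := dDL.1.
HB.instance Definition _ :=
  GRing.isLinear.Build C G (tensor A G) *:%R DL DL_linear.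

(** Compatibility with left multiplication, assumed for the elements a db only,
    extends to all forms because these span and the coproduct is
    multiplicative. *)
Lemma coaction_lact a g : DL (lact a g) = tact (comul a) (DL g).
Proof.
have tact_sum I (r : seq I) F (s : tensor A A) :
    tact s (\sum_(i <- r) F i : tensor A G) = \sum_(i <- r) tact s (F i).
  apply: (big_morph _ (tactDr s)).
  by apply: (addrI (tact s (0 : tensor A G))); rewrite -tactDr !addr0.
have [s ->] := fodc_span dF g.
rewrite [lact a _]raddf_sum !raddf_sum tact_sum; apply: eq_bigr => p _ /=.
by rewrite -lactM !dDL.2 comulM tactA.
Qed.

Lemma coaction_invariant a k :
  DL (lact a (w k)) = sw a (fun x y => x \ox lact y (w k)).
Proof.
rewrite coaction_lact wB.1; apply: eq_sw => x y.
by rewrite (tliftE (tact_balr _ x y)) mulr1.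
Qed.

(** The projection g |-> S(g_(-1)) g_(0) of a left Hopf module onto its
    coinvariants. *)
Definition inv_proj (g : G) : G := tlift (fun x h => lact (S x) h) (DL g).

Lemma inv_proj_bal : balanced (fun x (h : G) => lact (S x) h).
Proof. by split=> *; rewrite ?(raddfD, lactDl) // !linearZ lactZl. Qed.

Lemma inv_proj_linear : linear inv_proj.
Proof.
move=> c g h; rewrite /inv_proj linearP; apply: tlift_linear inv_proj_bal _ _ _ _.
by move=> k x y; rewrite linearZ /= lactZl.
Qed.

HB.instance Definition _ :=
  GRing.isLinear.Build C G G *:%R inv_proj inv_proj_linear.

Lemma inv_proj_lact a k : inv_proj (lact a (w k)) = counit a *: w k.
Proof.
rewrite /inv_proj coaction_invariant (sw_comp _ _ (tliftD inv_proj_bal)).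
transitivity (lact (sw a (fun x y => S x * y)) (w k)); last first.
  by rewrite sw_antipodel lactZl lact1.
rewrite [RHS](sw_comp (h := lact^~ (w k))); last by move=> x y; rewrite lactDl.
by apply: eq_sw => x y; rewrite (tliftE inv_proj_bal) lactM.
Qed.

Lemma invariant_comb (c : 'I_n -> C) : left_invariant DL (\sum_k c k *: w k).
Proof.
rewrite /left_invariant raddf_sum /= tens_sumr; apply: eq_bigr => k _.
by rewrite [LHS]linearZ /= wB.1 tensZr.
Qed.

Lemma basis_inj (c c' : 'I_n -> C) :
  \sum_k c k *: w k = \sum_k c' k *: w k -> c =1 c'.
Proof.
move=> e k; have [u [_ uU]] := wB.2 _ (invariant_comb c).
have h (v : 'I_n -> C) : \sum_k c k *: w k = \sum_k v k *: w k -> u = \row_k v k.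
  by move=> ev; apply: uU; rewrite {1}ev; apply: eq_bigr => i _; rewrite mxE.
by have /rowP/(_ k) := etrans (esym (h c erefl)) (h c' e); rewrite !mxE.
Qed.

(** The projection sends \sum_k a_k w_k to \sum_k eps(a_k) w_k, in the span of
    the basis, and the coefficients of a form in that span are unique.  Scalar
    coordinates are thus defined on all of Gamma without any choice of a
    complement, which is what makes [left_coordinates] possible without linear
    functionals on arbitrary vector spaces. *)
Lemma inv_coord : exists e : 'I_n -> G -> C,
  (forall j, scalar (e j)) /\
  forall j k a, e j (lact a (w k)) = (k == j)%:R * counit a.
Proof.
have /choice[e he] : forall g, exists c : 'I_n -> C, inv_proj g = \sum_k c k *: w k.
  move=> g; have [c {1}->] := w_span g; exists (fun k => counit (c k)).
  by rewrite raddf_sum; apply: eq_bigr => k _; exact: inv_proj_lact.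
exists (fun j g => e g j); split=> [j c g h|j k a].
  apply: (basis_inj (c := e _) (c' := fun k => c * e g k + e h k)).
  rewrite -he linearP /= !he scaler_sumr -big_split; apply: eq_bigr => k _.
  by rewrite scalerDl scalerA.
apply: (basis_inj (c := e _) (c' := fun j => (k == j)%:R * counit a)).
rewrite -he inv_proj_lact (bigD1 k) //= eqxx mul1r big1 ?addr0 // => i.
by rewrite eq_sym => /negPf ->; rewrite mul0r scale0r.
Qed.

(** A Hopf module is free over its coinvariants.  With e_j the scalar coordinates
    of [inv_coord], the map E_j = (id \ox e_j) o DL sends a w_k to
    a_(1) eps(a_(2)) delta_kj = delta_kj a. *)
Lemma left_coordinates : exists E : 'I_n -> G -> A,
  [/\ forall j, linear (E j),
      forall j k a, E j (lact a (w k)) = (k == j)%:R *: a &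
      forall g, g = \sum_k lact (E k g) (w k)].
Proof.
have [e [eL eE]] := inv_coord.
have eD j : {morph e j : g h / g + h}.
  by move=> g h; rewrite -[g in LHS]scale1r eL mul1r.
have e0 j : e j 0 = 0 by apply: (addrI (e j 0)); rewrite -eD !addr0.
have eZ j c g : e j (c *: g) = c * e j g by rewrite -[c *: g]addr0 eL e0 addr0.
have bal j : balanced (fun x g => e j g *: (x : A)).
  split=> *; rewrite ?scalerDr ?eD ?scalerDl // eZ scalerA.
  by rewrite mulrC.
pose E j g := tlift (fun x h => e j h *: (x : A)) (DL g).
have EL j : linear (E j).
  move=> c g h; rewrite /E linearP; apply: tlift_linear (bal j) _ _ _ _.
  by move=> k x y; rewrite !scalerA mulrC.
have EE j k a : E j (lact a (w k)) = (k == j)%:R *: a.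
  rewrite /E coaction_invariant (sw_comp _ _ (tliftD (bal j))).
  rewrite -[in RHS](counitr a) -/(sw a _) sw_scale; apply: eq_sw => x y.
  by rewrite (tliftE (bal j)) eE scalerA.
exists E; split=> // g; have [c ->] := w_span g; apply: eq_bigr => k _; congr lact.
pose Ek : {linear G -> A} := HB.pack (E k) (GRing.isLinear.Build C G A *:%R _ (EL k)).
rewrite -[E k _]/(Ek _) raddf_sum (bigD1 k) //= EE eqxx scale1r big1 ?addr0 // => i.
by rewrite EE => /negPf ->; rewrite scale0r.
Qed.

End Coordinates.

(** * Commutators in the cross product *)

Section CrossRelation.
Variables (C : numClosedFieldType) (A : hopfStarAlgType C).

Lemma alg_in_linear : linear (@alg_in C A).
Proof. by move=> c a b; rewrite /alg_in tensDl tensZl. Qed.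

HB.instance Definition _ :=
  GRing.isLinear.Build C A (crossprod A) *:%R (@alg_in C A) alg_in_linear.

Lemma cpact_sum I (r : seq I) (x : I -> crossprod A) c :
  cpact (\sum_(i <- r) x i) c = \sum_(i <- r) cpact (x i) c.
Proof.
apply: (big_morph (fun y => cpact y c) (cpactDl c)).
exact: tlift0 (cpact_bal c).
Qed.

Lemma cpactB (x y : crossprod A) c : cpact (x - y) c = cpact x c - cpact y c.
Proof. by rewrite cpactDl -scaleN1r cpactZ scaleN1r. Qed.

Lemma cpact_alg_dual a (g : dual A) c :
  cpact (alg_in a * dual_in g) c = a * (g |> c).
Proof. by rewrite alg_dual_in cpactE. Qed.

(** The action of the cross product on A is faithful, so a twisted Leibniz rule
    of g is a commutation relation; no formula for the coproduct of g in the dual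
    Hopf algebra is needed. *)
Lemma cross_commutator n (g : dual A) (Y h : 'I_n -> dual A) a :
    (forall c, g |> (a * c) = a * (g |> c) + \sum_k (Y k |> a) * (h k |> c)) ->
  dual_in g * alg_in a - alg_in a * dual_in g =
  \sum_k alg_in (Y k |> a) * dual_in (h k).
Proof.
move=> gM; apply: cpact_inj => c; rewrite cpactB cpact_alg_dual.
rewrite cpactM cpact_alg cpact_dual gM cpact_sum addrC addKr.
by apply: eq_bigr => k _; rewrite cpact_alg_dual.
Qed.

End CrossRelation.

(** * The symbol of a form *)

Lemma invariant_forms_span (C : numClosedFieldType) (A : hopfStarAlgType C)
    (G : bimodType A) (d : A -> G) n (w : 'I_n -> G) (X : 'I_n -> dual A) g :
  fodc d -> (forall a, d a = \sum_k lact (X k |> a) (w k)) ->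
  exists c : 'I_n -> A, g = \sum_k lact (c k) (w k).
Proof.
move=> dF dX; have [s ->] := fodc_span dF g.
exists (fun k => \sum_(p <- s) p.1 * (X k |> p.2)).
under [RHS]eq_bigr => k _ do rewrite lact_suml.
rewrite [RHS]exchange_big; apply: eq_bigr => p _ /=.
rewrite dX raddf_sum; apply: eq_bigr => k _.
by rewrite lactM.
Qed.

Section Functionals.
Variables (C : numClosedFieldType) (A : hopfStarAlgType C) (G : bimodType A).
Variables (d : A -> G) (n : nat) (w : 'I_n -> G).
Variables (X : 'I_n -> dual A) (f : 'I_n -> 'I_n -> dual A).
Variable E : 'I_n -> G -> A.
Hypothesis dF : fodc d.
Hypothesis Xf : associated_functionals d w X f.
Hypothesis EL : forall j, linear (E j).
Hypothesis EE : forall j k a, E j (lact a (w k)) = (k == j)%:R *: a.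

HB.instance Definition _ j := GRing.isLinear.Build C G A *:%R (E j) (EL j).

Lemma coord_comb (c : 'I_n -> A) j : E j (\sum_k lact (c k) (w k)) = c j.
Proof.
rewrite raddf_sum (bigD1 j) //= EE eqxx scale1r big1 ?addr0 // => i.
by rewrite EE => /negPf ->; rewrite scale0r.
Qed.

Lemma coord_d a j : E j (d a) = X j |> a.
Proof. by rewrite Xf.1 coord_comb. Qed.

Lemma coord_lact a g j :
  (exists c : 'I_n -> A, g = \sum_k lact (c k) (w k)) -> E j (lact a g) = a * E j g.
Proof.
case=> c ->; rewrite coord_comb raddf_sum /=.
by under eq_bigr => k _ do rewrite -lactM; rewrite coord_comb.
Qed.

Lemma coord_ract (c : 'I_n -> A) a j :
  E j (ract (\sum_k lact (c k) (w k)) a) = \sum_k c k * (f k j |> a).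
Proof.
pose r : {linear G -> G} :=
  HB.pack (fun g : G => ract g a) (GRing.isLinear.Build C G G *:%R _ (ract_linearl a)).
rewrite -[ract _ a]/(r _) !raddf_sum; apply: eq_bigr => k _ /=.
rewrite lractA Xf.2 coord_lact ?coord_comb //.
by exists (fun j => f k j |> a).
Qed.

(** The j-th coordinate of the Leibniz rule for d. *)
Lemma X_twisted_leibniz a b j :
  X j |> (a * b) = a * (X j |> b) + \sum_k (X k |> a) * (f k j |> b).
Proof.
rewrite -coord_d fodc_leibniz // raddfD /= coord_lact ?coord_d.
  by rewrite (Xf.1 a) coord_ract.
by exists (fun k => X k |> b); exact: Xf.1.
Qed.

(** The j-th coordinate of w_k 1 = w_k. *)
Lemma f_at_one k j : f k j |> 1 = (k == j)%:R.
Proof.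
transitivity (E j (ract (w k) 1)); first by rewrite Xf.2 coord_comb.
by rewrite ract1 -[w k]lact1 EE scaler_nat.
Qed.

(** The matrix entries of the operator that represents the form g, up to the
    factor i. *)
Definition symbol j g : crossprod A := \sum_k alg_in (E k g) * dual_in (f k j).

Lemma symbol_linear j : linear (symbol j).
Proof.
move=> c g h; rewrite /symbol scaler_sumr -big_split; apply: eq_bigr => k _.
by rewrite /= !linearP mulrDl scalerAl.
Qed.

Lemma symbol_lact_d a b j :
  symbol j (lact a (d b)) =
  alg_in a * (dual_in (X j) * alg_in b - alg_in b * dual_in (X j)).
Proof.
rewrite (cross_commutator (fun c => X_twisted_leibniz b c j)) mulr_sumr.
apply: eq_bigr => k _; rewrite coord_lact ?coord_d ?alg_inM ?mulrA //.
by exists (fun k => X k |> b); exact: Xf.1.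
Qed.

(** Nothing is lost in passing from a form to its symbols: the coordinates are
    recovered by letting the symbols act on the unit. *)
Lemma cpact_symbol1 j g : cpact (symbol j g) 1 = E j g.
Proof.
rewrite cpact_sum (bigD1 j) //= big1 => [|k /negPf kj].
  by rewrite cpact_alg_dual f_at_one eqxx mulr1 addr0.
by rewrite cpact_alg_dual f_at_one kj mulr0.
Qed.

End Functionals.

(** * Arrowhead operators on a direct sum *)

Section SubalgRep.
Variables (C : numClosedFieldType) (T : starAlgType C) (B : {pred T}).
Variables (H : hilbert C) (D : domain H) (pi : T -> D -> D).
Hypothesis BS : star_subalg B.
Hypothesis piR : star_rep B pi.

Lemma subalgL c x y : x \in B -> y \in B -> c *: x + y \in B.
Proof. by case: BS => -[_ h _] _; exact: h. Qed.

Lemma subalg0 : 0 \in B.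
Proof. by case: BS => -[h _ _] _; rewrite -(addNr 1) -scaleN1r subalgL. Qed.

Lemma subalgD x y : x \in B -> y \in B -> x + y \in B.
Proof. by move=> xB yB; rewrite -[x]scale1r; exact: subalgL. Qed.

Lemma subalgB x y : x \in B -> y \in B -> x - y \in B.
Proof. by move=> xB yB; rewrite addrC -scaleN1r; exact: subalgL. Qed.

Lemma subalgM x y : x \in B -> y \in B -> x * y \in B.
Proof. by case: BS => -[_ _ h] _; exact: h. Qed.

Lemma subalg_sum I (r : seq I) (x : I -> T) :
  (forall i, x i \in B) -> \sum_(i <- r) x i \in B.
Proof. by move=> xB; elim/big_rec: _ => [|i y _]; [exact: subalg0|exact: subalgD]. Qed.

Lemma repB x y v : x \in B -> y \in B -> pi (x - y) v = pi x v - pi y v.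
Proof.
move=> xB yB; rewrite addrC -scaleN1r (rep_linear piR) // scaleN1r.
by rewrite addrC.
Qed.

Lemma rep_opD x u v : x \in B -> pi x (u + v) = pi x u + pi x v.
Proof. by move=> xB; have := rep_op piR xB 1 u v; rewrite !scale1r. Qed.

Lemma rep_op0 x : x \in B -> pi x 0 = 0.
Proof. by move=> xB; apply: (addrI (pi x 0)); rewrite -rep_opD // !addr0. Qed.

Lemma rep_op_sum x I (r : seq I) (v : I -> D) : x \in B ->
  pi x (\sum_(i <- r) v i) = \sum_(i <- r) pi x (v i).
Proof.
move=> xB; exact: (big_morph _ (fun u v => rep_opD u v xB) (rep_op0 xB)).
Qed.

Variable n : nat.
Local Notation Dn := {ffun 'I_n.+1 -> D}.

(** The operator with matrix entries pi(x_k) in positions (0, k) and (k, 0), and 0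
    elsewhere. *)
Definition arrowhead (x : 'I_n -> T) (phi : Dn) : Dn :=
  [ffun i => if unlift ord0 i is Some k then pi (x k) (phi ord0)
             else \sum_(k < n) pi (x k) (phi (lift ord0 k))].

Lemma arrowhead0 x phi : arrowhead x phi ord0 = \sum_k pi (x k) (phi (lift ord0 k)).
Proof. by rewrite ffunE unlift_none. Qed.

Lemma arrowheadS x phi k : arrowhead x phi (lift ord0 k) = pi (x k) (phi ord0).
Proof. by rewrite ffunE liftK. Qed.

Lemma ffun_ordP (phi psi : Dn) : phi ord0 = psi ord0 ->
  (forall k, phi (lift ord0 k) = psi (lift ord0 k)) -> phi = psi.
Proof.
move=> h0 hS; apply/ffunP => i.
by case: (unliftP ord0 i) => [k|] ->; [exact: hS|].
Qed.

Lemma arrowhead_linear x : (forall k, x k \in B) -> linear (arrowhead x).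
Proof.
move=> xB c phi psi; apply: ffun_ordP => [|k]; rewrite !ffunE ?unlift_none ?liftK.
  rewrite scaler_sumr -big_split; apply: eq_bigr => k _ /=.
  by rewrite !ffunE (rep_op piR).
exact: (rep_op piR).
Qed.

Lemma arrowhead_linearl c x y phi : (forall k, x k \in B) -> (forall k, y k \in B) ->
  arrowhead (fun k => c *: x k + y k) phi = c *: arrowhead x phi + arrowhead y phi.
Proof.
move=> xB yB; apply: ffun_ordP => [|k]; rewrite !ffunE ?unlift_none ?liftK.
  rewrite scaler_sumr -big_split; apply: eq_bigr => k _ /=.
  exact: (rep_linear piR).
exact: (rep_linear piR).
Qed.

(** The terms of the two sides are exchanged in pairs: the first row of one side
    matches the first column of the other. *)
Lemma arrowhead_symmetric x (phi psi : domain_sum n.+1 D) :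
  (forall k, x k \in B) -> (forall k, star (x k) = x k) ->
  dip (arrowhead x phi : domain_sum n.+1 D) psi =
  dip phi (arrowhead x psi : domain_sum n.+1 D).
Proof.
move=> xB xS.
have dip_sumE (u v : domain_sum n.+1 D) :
    dip u v = \sum_i dip ((u : Dn) i) ((v : Dn) i).
  by apply: eq_bigr => i _; rewrite !ffunE.
have dip_suml I (r : seq I) (u : I -> D) (v : D) :
    dip (\sum_(i <- r) u i) v = \sum_(i <- r) dip (u i) v.
  by rewrite /dip raddf_sum linear_sumlz.
have dip_sumr I (r : seq I) (u : I -> D) (v : D) :
    dip v (\sum_(i <- r) u i) = \sum_(i <- r) dip v (u i).
  by rewrite /dip raddf_sum linear_sumr.
rewrite !dip_sumE !big_ord_recl /= !arrowhead0 dip_suml dip_sumr addrC.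
by congr (_ + _); apply: eq_bigr => k _; rewrite arrowheadS (rep_star piR) ?xS.
Qed.

Definition diag (a : T) (phi : Dn) : Dn := [ffun i => pi a (phi i)].

Lemma arrowhead_commutator a x phi : a \in B -> (forall k, x k \in B) ->
  arrowhead x (diag a phi) - diag a (arrowhead x phi) =
  arrowhead (fun k => x k * a - a * x k) phi.
Proof.
move=> aB xB.
have h k v : pi (x k) (pi a v) - pi a (pi (x k) v) = pi (x k * a - a * x k) v.
  by rewrite repB ?subalgM // !(repM piR).
apply: ffun_ordP => [|k]; rewrite !ffunE ?unlift_none ?liftK ?ffunE ?h //.
rewrite rep_op_sum // -sumrB; apply: eq_bigr => k _; rewrite ffunE; exact: h.
Qed.

Lemma diag_arrow a x phi : a \in B -> (forall k, x k \in B) ->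
  diag a (arrowhead x phi) = arrowhead (fun k => a * x k) phi.
Proof.
move=> aB xB; apply: ffun_ordP => [|k]; rewrite !ffunE ?unlift_none ?liftK.
  by rewrite rep_op_sum //; apply: eq_bigr => k _; rewrite (repM piR).
by rewrite (repM piR).
Qed.

Lemma arrowhead_inj x y : arrowhead x =1 arrowhead y -> forall k, pi (x k) =1 pi (y k).
Proof.
move=> h k v; have := congr1 (fun phi : Dn => phi (lift ord0 k)) (h [ffun=> v]).
by rewrite !arrowheadS !ffunE.
Qed.

End SubalgRep.

(** * The commutator representation *)

Lemma sum_rep_star_rep (C : numClosedFieldType) (A : hopfStarAlgType C) n
    (B : {pred crossprod A}) (H : hilbert C) (D : domain H)
    (pi1 : crossprod A -> D -> D) :
  (forall a, alg_in a \in B) -> star_rep B pi1 ->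
  star_rep predT (D := domain_sum n.+1 D) (sum_rep n pi1).
Proof.
move=> algB piR.
split=> [a _ c phi psi|a b _ _ c phi|phi|a b _ _ phi|a _ phi psi].
- by apply/ffunP => i; rewrite !ffunE (rep_op piR) ?algB.
- apply/ffunP => i; rewrite !ffunE [alg_in _]linearP.
  by rewrite (rep_linear piR) ?algB.
- apply/(@ffunP _ _ (sum_rep n pi1 1 phi)) => i.
  by rewrite !ffunE -[alg_in 1]/(1 : crossprod A) (rep1 piR).
- by apply/ffunP => i; rewrite !ffunE alg_inM (repM piR) ?algB.
- apply: eq_bigr => i _; rewrite !ffunE -cpstar_alg.
  exact: (rep_star piR).
Qed.

Theorem theorem2 (R : realType) (A : hopfStarAlgType R[i])
    (Gamma : bimodType A) (d : A -> Gamma) (DeltaL : Gamma -> tensor A Gamma)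
    (n : nat) (omega : 'I_n -> Gamma)
    (X : 'I_n -> dual A) (f : 'I_n -> 'I_n -> dual A)
    (U0 : {pred dual A})
    (H : hilbert R[i]) (D : domain H) (pi1 : crossprod A -> D -> D)
    (d_star_calculus : star_calculus d)
    (d_left_covariant : left_coaction d DeltaL)
    (omega_basis : invariant_basis DeltaL omega)
    (X_f_associated : associated_functionals d omega X f)
    (X_hermitean : forall j, star (X j) = X j)
    (U0_star_subalg : star_subalg U0)
    (X_in_U0 : forall j, X j \in U0)
    (f_in_U0 : forall k j, f k j \in U0)
    (pi1_star_rep : star_rep (subcrossprod U0) pi1) :
  let pi := sum_rep n pi1 in
  let F := sum_op pi1 X in
  commutator_rep d (E := domain_sum n.+1 D) pi F /\
  (faithful_rep (subcrossprod U0) pi1 ->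
   faithful_commutator_rep d (E := domain_sum n.+1 D) pi F).
Proof.
move=> pi F.
have BS : star_subalg (subcrossprod U0) := star_gen_subalg _.
have algB a : alg_in a \in subcrossprod U0.
  by apply/asboolP => B' _; apply; apply/asboolP; left; exists a.
have dualB g : g \in U0 -> dual_in g \in subcrossprod U0.
  by move=> gU; apply/asboolP => B' _; apply; apply/asboolP; right; exists g.
have dF := star_calculus_fodc d_star_calculus.
have w_span g := invariant_forms_span g dF X_f_associated.1.
have [E [EL EE Ew]] := left_coordinates dF d_left_covariant omega_basis w_span.
pose sy k g := symbol f E k g.
have syB k g : sy k g \in subcrossprod U0.
  by apply: (subalg_sum BS) => j; apply: (subalgM BS); [exact: algB|exact: dualB].
have XB k : dual_in (X k) \in subcrossprod U0 by exact: dualB.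
have starX k : star (dual_in (X k)) = dual_in (X k).
  by rewrite -[LHS]/(cpstar _) cpstar_dual X_hermitean.
pose tau g phi : domain_sum n.+1 D := 'i *: arrowhead pi1 (fun k => sy k g) phi.
have tauP : commutator_map d (E := domain_sum n.+1 D) pi F tau.
  split=> [g c phi psi|c g h phi|a b phi]; rewrite /tau.
  - rewrite (arrowhead_linear pi1_star_rep) // scalerDr !scalerA; congr (_ *: _ + _).
    by rewrite mulrC.
  - have -> : (fun k => sy k (c *: g + h)) = (fun k => c *: sy k g + sy k h).
      by apply/funext => k; rewrite /sy symbol_linear.
    rewrite (arrowhead_linearl pi1_star_rep) // scalerDr !scalerA; congr (_ *: _ + _).
    by rewrite mulrC.
  - congr ('i *: _).
    have -> : (fun k => sy k (lact a (d b))) = (fun k => alg_in a *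
        (dual_in (X k) * alg_in b - alg_in b * dual_in (X k))).
      by apply/funext => k; exact: (symbol_lact_d dF X_f_associated EL EE).
    rewrite -(diag_arrow pi1_star_rep) //; last first.
      by move=> k; apply: (subalgB BS); exact: (subalgM BS).
    congr diag; rewrite -(arrowhead_commutator BS pi1_star_rep) //.
have CR : commutator_rep d (E := domain_sum n.+1 D) pi F.
  split; last by exists tau.
  - exact: sum_rep_star_rep algB pi1_star_rep.
  - exact: (arrowhead_linear pi1_star_rep).
  - by move=> phi psi; apply: (arrowhead_symmetric pi1_star_rep).
split=> // pi1_faithful; split=> //; exists tau => // g h gh.
have {}gh : arrowhead pi1 (fun k => sy k g) =1 arrowhead pi1 (fun k => sy k h).
  by move=> phi; apply: (scalerI (neq0Ci _)); exact: gh.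
rewrite (Ew g) (Ew h); apply: eq_bigr => k _.
rewrite -!(cpact_symbol1 X_f_associated EL EE).
by congr (lact (cpact _ _) _); apply: pi1_faithful => //; exact: arrowhead_inj gh k.
Qed.
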